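(* Let $A_0,\dots,A_{\bm r}$ be real matrices, $A_i$ of size $N_i\times d$, and for $h\ge0$ set $\mathcal A_h=\sum_{i=0}^{\bm r}h^{2i}\,{}^t\!A_iA_i$. Assume $\bigcap_{i=0}^{\bm r}\ker A_i=\{0\}$ (equivalently, the block matrix ${}^t(A_0,hA_1,\dots,h^{\bm r}A_{\bm r})$ has rank $d$ for $h>0$). Define $\mathcal V_0=\mathrm{Im}({}^t\!A_0A_0)$ and, for $1\le j\le\bm r$, $\hat A_j=P_{j-1}\,{}^t\!A_jA_j|_{\mathcal V_{j-1}^\perp}$ (a symmetric operator on $\mathcal V_{j-1}^\perp$, where $P_{j-1}$ is the orthogonal projection of $\mathbb R^d$ onto $\mathcal V_{j-1}^\perp$ and $\perp$ refers to the standard inner product), $\mathcal V_j=\mathcal V_{j-1}+\mathrm{Im}(\hat A_j)$; set $\hat A_0={}^t\!A_0A_0$, $n_j=\dim\mathcal V_j$, $n_{-1}=0$. Then $n_{\bm r}=d$, and the $d$ eigenvalues of $\mathcal A_h$ (counted with multiplicity) are given by real-analytic eigenbranches which can be grouped so that, for each $0\le j\le\bm r$, there are exactly $n_j-n_{j-1}$ branches of the form $\lambda^j_i(h)=h^{2j}\eta^j_i(h)$, $1\le i\le n_j-n_{j-1}$, where the analytic functions $\eta^j_i(h)$ converge as $h\to0$ to the $n_j-n_{j-1}$ nonzero eigenvalues (with multiplicity) of $\hat A_j$.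
   Context: ${}^t\!A$ denotes the transpose of $A$. Since $\mathcal A_h$ is a real-analytic family of symmetric matrices, its eigenvalues can be organized into real-analytic branches in $h$. *)

(* Defs.v *)
From HB Require Import structures.
From mathcomp Require Import all_boot all_order all_algebra.
From mathcomp Require Import all_classical all_reals all_analysis.
Set Implicit Arguments. Unset Strict Implicit. Unset Printing Implicit Defensive.
Import Order.TTheory GRing.Theory Num.Theory.
Import numFieldNormedType.Exports.
Local Open Scope classical_set_scope.
Local Open Scope ring_scope.

Definition real_analytic (R : realType) (f : R -> R) : Prop :=
  forall x0 : R, exists (a : nat -> R) (e : R), 0 < e /\
    forall x : R, `|x - x0| < e ->
      series (fun k => a k * (x - x0) ^+ k) @ \oo --> f x.

Section Construction.
Variables (R : realType) (d : nat) (N : nat -> nat)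
          (A : forall i : nat, 'M[R]_(N i, d)).

Definition AtA (i : nat) : 'M[R]_d := (A i)^T *m A i.

Definition Acal (r : nat) (h : R) : 'M[R]_d :=
  \sum_(i < r.+1) (h ^+ (2 * i)) *: AtA i.

Definition orthmx (V : 'M[R]_d) : 'M[R]_d := kermx V^T.

Definition orthproj (V : 'M[R]_d) : 'M[R]_d := proj_mx (orthmx V) V.

(* The subspaces V_j (as row spaces of d x d matrices) and the operators
   Ahat_j, the latter represented on all of R^d by P_{j-1} ^tA_j A_j P_{j-1}
   (equal to Ahat_j on V_{j-1}^perp and to 0 on V_{j-1}). *)
Fixpoint Vsp (j : nat) : 'M[R]_d :=
  match j with
  | 0 => AtA 0
  | j'.+1 => (Vsp j' + orthproj (Vsp j') *m AtA j'.+1 *m orthproj (Vsp j'))%MS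
  end.

Definition Ahat (j : nat) : 'M[R]_d :=
  match j with
  | 0 => AtA 0
  | j'.+1 => orthproj (Vsp j') *m AtA j'.+1 *m orthproj (Vsp j')
  end.

Definition ndim (j : nat) : nat := \rank (Vsp j).
Definition nprev (j : nat) : nat := if j is j'.+1 then ndim j' else 0%N.

End Construction.

(* Main.v *)
Require Import Defs.
From HB Require Import structures.
From mathcomp Require Import all_boot all_order all_algebra.
From mathcomp Require Import all_classical all_reals all_analysis.
From mathcomp Require Import perm ring lra zify complex.
Import Order.TTheory GRing.Theory Num.Theory.
Import numFieldNormedType.Exports.
Local Open Scope classical_set_scope.
Local Open Scope ring_scope.
Set Implicit Arguments.
Unset Strict Implicit.
Unset Printing Implicit Defensive.

(** Branches exist by Rellich's theorem, proved on characteristic polynomials.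
    Locally, after shifting the mean of the roots to 0, the sum of squares of the
    roots is either identically 0 or h^(2m) u(h) with u(0) > 0; then all roots
    are O(h^m), the rescaled family x = h^m y has at least two distinct roots at
    h = 0, and Hensel's lemma splits it into families of smaller degree. Local
    branches are glued along the line by the identity theorem.

    Let E(h) act as h^min(a,j) on V_a minus V_(a-1). Since A_l vanishes on the
    orthogonal complement of V_l, h^(2j) y - A_h = E(h) M(h, y) E(h) with M
    polynomial in h, and det M(0, y) is, up to a nonzero constant and a power of
    y, the characteristic polynomial of Ahat_j. Writing the branches as
    h^(2m) eta(h) with eta(0) <> 0 and letting h -> 0 in
    det (h^(2j) y - A_h) = prod (h^(2j) y - h^(2m) eta(h)) identifies the eta(0)
    with m = j as the nonzero eigenvalues of Ahat_j. *)

(** * Germs of analytic functions *)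

(** Real-rootedness is what rules out fractional powers of [h]. The sum of squares of the centred
    roots is nonnegative on both sides of 0, so its order there is even, and it bounds each single
    root; the coefficient of degree k is then O(h^(m(n-k))), hence divisible by that power. The same
    parity argument produces the factors h^(2m) of the eigenbranches, because A_h is positive
    semidefinite for [h] of either sign; this is why the branches are built on the whole line. The
    cap min(a,j) in E(h) isolates one operator: at h = 0 the layers below j contribute the
    invertible blocks -Ahat_l, layer j contributes y - Ahat_j, and the layers above j contribute y
    alone. The degree in y then counts the branches with m >= j, the dimension n_j - n_(j-1) is a
    difference of two consecutive counts, and j = r+1 excludes m > r. The determinant identity
    carries prefactors that may vanish at h = 0, so it is used as a proportion between two values of
    y before the limit is taken. *)

Section PowerSeries.
Variable R : realType.
Implicit Types (a b : nat -> R) (f g : R -> R).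

Definition psum a n x := \sum_(k < n) a k * x ^+ k.

(* f has power series a at 0, with a geometric bound on every remainder: this
   finitary form gives convergence and is directly stable under products. *)
Definition has_ps a f := exists M B, [/\ 0 < M, 0 <= B &
  forall n x, M * `|x| <= 1 -> `|f x - psum a n x| <= B * (M * `|x|) ^+ n].

Definition analytic0 f := exists a, has_ps a f.

Lemma psumS a n x : psum a n.+1 x = psum a n x + a n * x ^+ n.
Proof. by rewrite /psum big_ord_recr. Qed.

(** Subtracting the remainders of orders [k] and [k.+1] at [M^-1] isolates the term of degree [k],
    whence the factor 2. Allowing all larger [M'] and [B'] lets two series share their constants. *)
Lemma has_ps_bounds a f : has_ps a f -> exists M B, [/\ 0 < M, 0 <= B &
  forall M' B', M <= M' -> B <= B' -> (forall k, `|a k| <= B' * M' ^+ k) /\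
  forall n x, M' * `|x| <= 1 -> `|f x - psum a n x| <= B' * (M' * `|x|) ^+ n].
Proof.
case=> M [B [M0 B0 H]]; exists M, (2 * B); split=> // [|M' B' MM' BB'].
  by rewrite mulr_ge0.
have M'0 : 0 < M' by apply: lt_le_trans MM'.
have BB'' : B <= B' by apply: le_trans BB'; lra.
split=> [k|n x Hx].
  apply: (@le_trans _ _ (2 * B * M ^+ k)); last first.
    apply: ler_pM => //; first by lra.
      by rewrite exprn_ge0 // ltW.
    by rewrite lerXn2r // ?nnegrE ltW.
  have MVn : `|M^-1| = M^-1 by rewrite gtr0_norm // invr_gt0.
  have MV : M * `|M^-1| <= 1 by rewrite MVn mulfV ?gt_eqF.
  have H1 := H k _ MV; have H2 := H k.+1 _ MV.
  move: H1 H2; rewrite MVn mulfV ?gt_eqF // !expr1n mulr1.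
  rewrite psumS => H1 H2.
  have : `|a k * M^-1 ^+ k| <= 2 * B.
    move: H1 H2; rewrite !ler_norml; lra.
  rewrite normrM exprVn normfV (gtr0_norm (exprn_gt0 k M0)).
  by rewrite ler_pdivrMr // exprn_gt0.
have le1 : M * `|x| <= M' * `|x| by rewrite ler_wpM2r.
apply: le_trans (H n x (le_trans le1 Hx)) _.
apply: ler_pM => //; first by rewrite exprn_ge0 // mulr_ge0 // ltW.
by rewrite lerXn2r // nnegrE mulr_ge0 // ltW.
Qed.

Lemma has_ps_pair a f b g : has_ps a f -> has_ps b g -> exists M B, [/\ 0 < M, 0 <= B,
  (forall k, `|a k| <= B * M ^+ k), (forall k, `|b k| <= B * M ^+ k) &
  forall n x, M * `|x| <= 1 -> `|f x - psum a n x| <= B * (M * `|x|) ^+ n /\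
   `|g x - psum b n x| <= B * (M * `|x|) ^+ n].
Proof.
move=> /has_ps_bounds[M1 [B1 [M10 B10 H1]]] /has_ps_bounds[M2 [B2 [M20 B20 H2]]].
have [|//|Ha Hf] := H1 (M1 + M2) (B1 + B2); [lra|lra|].
have [|//|Hb Hg] := H2 (M1 + M2) (B1 + B2); [lra|lra|].
exists (M1 + M2), (B1 + B2); split=> //; [lra|lra|].
by move=> n x Hx; split; [exact: Hf|exact: Hg].
Qed.

Lemma small_near (M : R) : 0 < M -> \forall x \near (0 : R), M * `|x| <= 1.
Proof.
move=> M0; apply/nbhs_ballP; exists M^-1 => /=; first by rewrite invr_gt0.
move=> x /=; rewrite /ball /= sub0r normrN => /ltW Hx.
by rewrite -ler_pdivlMl // mulr1.
Qed.

Lemma has_ps_ext a f g : (\forall x \near (0 : R), f x = g x) -> has_ps a f -> has_ps a g.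
Proof.
move=> /nbhs_ballP[e /= e0 He] /has_ps_bounds[M [B [M0 B0 H]]].
(* The extra [2 / e] forces [|x| <= e / 2], inside the ball on which [f] and [g] agree. *)
have [|//|_ Hf] := H (M + 2 / e) B; first by rewrite lerDl divr_ge0 // ltW.
have M'0 : 0 < M + 2 / e by rewrite addr_gt0 // divr_gt0.
exists (M + 2 / e), B; split=> // n x Hx.
rewrite -He ?Hf // /ball /= sub0r normrN.
have : 2 / e * `|x| <= 1.
  apply: le_trans Hx; rewrite ler_wpM2r // lerDr ltW //.
rewrite mulrAC ler_pdivrMr // mul1r; have := normr_ge0 x; lra.
Qed.

Lemma has_ps_coef a b f : a =1 b -> has_ps a f -> has_ps b f.
Proof.
move=> ab [M [B [M0 B0 H]]]; exists M, B; split=> // n x Hx.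
rewrite (_ : psum b n x = psum a n x) ?H //.
by apply: eq_bigr => i _; rewrite ab.
Qed.

Lemma analytic0_ext f g : (\forall x \near (0 : R), f x = g x) -> analytic0 f -> analytic0 g.
Proof. by move=> fg [a Ha]; exists a; apply: has_ps_ext Ha. Qed.

Lemma analytic0_eq f g : f =1 g -> analytic0 f -> analytic0 g.
Proof. by move=> fg; apply: analytic0_ext; apply: filterS filterT => x _; apply: fg. Qed.
Arguments analytic0_eq [f g].

Lemma has_ps_cst c : has_ps (fun k => if k is 0%N then c else 0) (fun _ => c).
Proof.
exists 1, `|c|; split=> // n x; rewrite mul1r => Hx.
case: n => [|n]; first by rewrite /psum big_ord0 subr0 mulr1.
rewrite /psum big_ord_recl /= expr0 mulr1 big1 ?addr0 ?subrr ?normr0.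
  by rewrite mulr_ge0 // exprn_ge0.
by move=> i _; rewrite /= mul0r.
Qed.

Lemma analytic0_cst c : analytic0 (fun _ => c).
Proof. by eexists; apply: has_ps_cst. Qed.

Lemma has_psD a f b g : has_ps a f -> has_ps b g ->
  has_ps (fun k => a k + b k) (fun x => f x + g x).
Proof.
move=> Hf Hg; have [M [B [M0 B0 _ _ H]]] := has_ps_pair Hf Hg.
exists M, (B + B); split=> //; first lra.
move=> n x /(H n)[h1 h2].
have -> : psum (fun k => a k + b k) n x = psum a n x + psum b n x.
  by rewrite /psum -big_split; apply: eq_bigr => i _; rewrite mulrDl.
by rewrite opprD addrACA mulrDl (le_trans (ler_normD _ _)) // lerD.
Qed.

(** Summation over the triangle p + q < n. Both the remainder bound for products and the norm
    estimate for Cauchy products start from this form. *)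
Lemma psumM a b n x :
  psum (fun m => \sum_(p < m.+1) a p * b (m - p)%N) n x =
  \sum_(p < n) a p * x ^+ p * psum b (n - p) x.
Proof.
elim: n => [|n IHn]; first by rewrite /psum !big_ord0.
rewrite psumS IHn [in RHS]big_ord_recr /= subSn // subnn psumS [psum b 0 x]big_ord0 add0r expr0.
rewrite mulr1 big_ord_recr /= subnn mulrDl addrA; congr (_ + _); last by rewrite mulrAC.
rewrite mulr_suml -big_split; apply: eq_bigr => i _ /=.
rewrite subSn 1?ltnW // psumS mulrDr; congr (_ + _).
have -> : x ^+ n = x ^+ i * x ^+ (n - i) by rewrite -exprD subnKC // ltnW.
ring.
Qed.

Lemma succ_le_double_exp n : (1 + n <= 2 * 2 ^ n)%N.
Proof. by have := ltn_expl n (isT : (1 < 2)%N); lia. Qed.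

(** The remainder is [(f - psum a n) * g] plus [n] terms [a p * x ^+ p * (g - psum b (n - p))], each
    at most [B * B * t ^+ n]. Doubling [M] absorbs the resulting factor n + 1. *)
Lemma has_psM a f b g : has_ps a f -> has_ps b g ->
  has_ps (fun m => \sum_(p < m.+1) a p * b (m - p)%N) (fun x => f x * g x).
Proof.
move=> Hf Hg; have [M [B [M0 B0 Ha Hb H]]] := has_ps_pair Hf Hg.
exists (2 * M), (B * B * 2); split=> //; first lra.
  by rewrite !mulr_ge0.
move=> n x Hx; rewrite psumM; set t := M * `|x|.
have t0 : 0 <= t by rewrite mulr_ge0 // ltW.
have t1 : t <= 1 by move: Hx; rewrite -mulrA -/t; lra.
have [h1 h2] := H n x t1.
have g0 : `|g x| <= B.
  by have [_] := H 0 x t1; rewrite /psum big_ord0 subr0 expr0 mulr1.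
have -> : f x * g x - \sum_(p < n) a p * x ^+ p * psum b (n - p) x =
    (f x - psum a n x) * g x + \sum_(p < n) a p * x ^+ p * (g x - psum b (n - p) x).
  rewrite mulrBl -addrA; congr (_ + _); rewrite /psum mulr_suml -sumrN -sumrN -big_split.
  by apply: eq_bigr => i _ /=; rewrite mulrBr addrA addNr add0r.
apply: le_trans (ler_normD _ _) _.
have : `|(f x - psum a n x) * g x| <= B * B * t ^+ n.
  by rewrite normrM mulrAC ler_pM.
have : `|\sum_(p < n) a p * x ^+ p * (g x - psum b (n - p) x)| <= \sum_(p < n) B * B * t ^+ n.
  apply: le_trans (ler_norm_sum _ _ _) _; apply: ler_sum => p _.
  rewrite normrM.
  have -> : B * B * t ^+ n = (B * t ^+ p) * (B * t ^+ (n - p)).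
    have -> : t ^+ n = t ^+ p * t ^+ (n - p) by rewrite -exprD subnKC // ltnW.
    ring.
  apply: ler_pM => //; last by have [] := H (n - p)%N x t1.
  rewrite normrM normrX exprMn mulrA ler_wpM2r // exprn_ge0 //.
rewrite sumr_const card_ord -[_ *+ n]mulr_natr => h3 h4.
have -> : 2 * M * `|x| = 2 * t by rewrite /t mulrA.
rewrite exprMn.
have n2 : 1 + n%:R <= 2 * 2 ^+ n :> R.
  by rewrite -natrX -natrM -[1]/(1%:R) -natrD ler_nat succ_le_double_exp.
have t0n : 0 <= B * B * t ^+ n by rewrite !mulr_ge0 // exprn_ge0.
have := ler_wpM2l t0n n2; move: h3 h4; lra.
Qed.

Lemma analytic0D f g : analytic0 f -> analytic0 g -> analytic0 (fun x => f x + g x).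
Proof. by move=> [a Ha] [b Hb]; eexists; apply: has_psD Ha Hb. Qed.

Lemma analytic0M f g : analytic0 f -> analytic0 g -> analytic0 (fun x => f x * g x).
Proof. by move=> [a Ha] [b Hb]; eexists; apply: has_psM Ha Hb. Qed.

Lemma analytic0N f : analytic0 f -> analytic0 (fun x => - f x).
Proof.
move=> Hf; by apply: (analytic0_eq _ (analytic0M (analytic0_cst (-1)) Hf)) => x; rewrite mulN1r.
Qed.

Lemma analytic0B f g : analytic0 f -> analytic0 g -> analytic0 (fun x => f x - g x).
Proof. by move=> Hf Hg; apply: analytic0D => //; apply: analytic0N. Qed.

Lemma analytic0_sum (I : Type) (r : seq I) (P : pred I) (F : I -> R -> R) :
  (forall i, P i -> analytic0 (F i)) -> analytic0 (fun x => \sum_(i <- r | P i) F i x).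
Proof.
move=> HF; elim: r => [|i r IHr].
  by apply: (analytic0_eq _ (analytic0_cst 0)) => x; rewrite big_nil.
case layer_proj: (P i).
  by apply: (analytic0_eq _ (analytic0D (HF i layer_proj) IHr)) => x; rewrite big_cons layer_proj.
by apply: (analytic0_eq _ IHr) => x; rewrite big_cons layer_proj.
Qed.

Lemma analytic0_prod (I : Type) (r : seq I) (P : pred I) (F : I -> R -> R) :
  (forall i, P i -> analytic0 (F i)) -> analytic0 (fun x => \prod_(i <- r | P i) F i x).
Proof.
move=> HF; elim: r => [|i r IHr].
  by apply: (analytic0_eq _ (analytic0_cst 1)) => x; rewrite big_nil.
case layer_proj: (P i).
  by apply: (analytic0_eq _ (analytic0M (HF i layer_proj) IHr)) => x; rewrite big_cons layer_proj.
by apply: (analytic0_eq _ IHr) => x; rewrite big_cons layer_proj.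
Qed.

Lemma analytic0X f n : analytic0 f -> analytic0 (fun x => f x ^+ n).
Proof.
move=> Hf; elim: n => [|n IHn]; first exact: analytic0_cst.
by apply: (analytic0_eq _ (analytic0M Hf IHn)) => x; rewrite exprS.
Qed.

Lemma analytic0_id : analytic0 id.
Proof.
exists (fun k => (k == 1%N)%:R); exists 1, 1; split=> // n x; rewrite !mul1r => Hx.
case: n => [|[|n]].
- by rewrite /psum big_ord0 subr0 expr0.
- by rewrite /psum big_ord1 mul0r subr0 expr1.
rewrite /psum 2!big_ord_recl /= mul0r add0r mul1r expr1 big1 ?addr0 ?subrr ?normr0.
  by rewrite exprn_ge0.
by move=> i _; rewrite /= mul0r.
Qed.

(** The remainder of the geometric series is exactly [(- x / c) ^+ n / (c + x)]; the constant
    [2 / |c|] restricts to [|x| <= |c| / 2], where [|c + x| >= |c| / 2]. *)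
Lemma analytic0_inv c : c != 0 -> analytic0 (fun y => (c + y)^-1).
Proof.
move=> c0; exists (fun k => (-1) ^+ k / c ^+ k.+1).
have cp : 0 < `|c| by rewrite normr_gt0.
exists (2 / `|c|), (2 / `|c|); split; rewrite ?divr_gt0 ?divr_ge0 //.
move=> n x; rewrite mulrAC ler_pdivrMr // mul1r => Hx.
have cx : `|c| / 2 <= `|c + x|.
  have := ler_normB (c + x) x; rewrite addrK; have := normr_ge0 x; lra.
have cx0 : c + x != 0 by rewrite -normr_gt0; apply: lt_le_trans cx; rewrite divr_gt0.
have -> : (c + x)^-1 - psum (fun k => (-1) ^+ k / c ^+ k.+1) n x
   = (- x / c) ^+ n / (c + x).
  elim: n => [|n IHn]; first by rewrite /psum big_ord0 subr0 mul1r.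
  rewrite psumS opprD addrA IHn [in RHS]exprS.
  have -> : (-1) ^+ n / c ^+ n.+1 * x ^+ n = (- x / c) ^+ n / c.
    by rewrite expr_div_n -[- x]mulN1r exprMn exprSr invfM; ring.
  by field; rewrite c0 cx0.
rewrite normrM normfV normrX normrM normrN normfV mulrC.
apply: ler_pM.
- by rewrite invr_ge0.
- by rewrite exprn_ge0 // divr_ge0.
- rewrite -[2 / `|c|]invf_div lef_pV2 // posrE ?divr_gt0 // normr_gt0 //.
- rewrite lerXn2r // ?nnegrE ?divr_ge0 ?mulr_ge0 //.
  rewrite ler_wpM2r ?invr_ge0 //; have := normr_ge0 x; lra.
Qed.

Lemma has_ps0 a f : has_ps a f -> f 0 = a 0%N.
Proof.
case=> M [B [M0 B0 H]]; have := H 1%N 0; rewrite normr0 mulr0 expr1 mulr0 psumS.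
rewrite /psum big_ord0 add0r expr0 mulr1 => /(_ ler01).
by rewrite normr_le0 subr_eq0 => /eqP.
Qed.

Lemma analytic0_continuous f : analytic0 f -> f x @[x --> (0 : R)] --> f 0.
Proof.
case=> a Ha; rewrite (has_ps0 Ha); case: Ha => M [B [M0 B0 H]].
apply/cvgrPdist_le => e e0.
near=> x.
have Mx : M * `|x| <= 1 by near: x; apply: small_near.
have := H 1%N x Mx; rewrite expr1 psumS /psum big_ord0 add0r expr0 mulr1 distrC.
move=> /le_trans; apply.
have : (B + 1) * M / e * `|x| <= 1.
  by near: x; apply: small_near; rewrite divr_gt0 // mulr_gt0 //; lra.
rewrite mulrAC ler_pdivrMr // mul1r.
apply: le_trans; rewrite mulrA ler_wpM2r // ler_wpM2r ?(ltW M0) //; lra.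
Unshelve. all: by end_near.
Qed.

Lemma analytic0_near_neq0 f : analytic0 f -> f 0 != 0 -> \forall x \near (0 : R), f x != 0.
Proof.
move=> /analytic0_continuous Hf f0.
have : \forall x \near (0 : R), `|f 0 - f x| < `|f 0|.
  by move/cvgrPdist_lt : Hf => /(_ `|f 0|); rewrite normr_gt0 => /(_ f0).
apply: filterS => x; apply: contraTneq => ->; by rewrite subr0 ltxx.
Qed.

Lemma geom_sum_le2 (t : R) n : 0 <= t -> t <= 1 / 2 -> \sum_(k < n) t ^+ k <= 2.
Proof.
move=> t0 t1; elim: n => [|n IHn]; first by rewrite big_ord0.
rewrite big_ord_recl expr0.
under eq_bigr do rewrite /= /bump /= add1n exprS.
rewrite -mulr_sumr.
have : t * \sum_(i < n) t ^+ i <= 1 / 2 * 2 by apply: ler_pM => //; apply: sumr_ge0 => i _; rewrite exprn_ge0.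
lra.
Qed.

Lemma near0_pos (P : R -> Prop) : (\forall x \near (0 : R), P x) ->
  exists x, [/\ 0 < x, P x & P (- x)].
Proof.
move=> /nbhs_ballP[e /= e0 He]; exists (e / 2); rewrite divr_gt0 //.
by split=> //; apply: He; rewrite /ball /= sub0r ?opprK ?normrN gtr0_norm ?divr_gt0 //; lra.
Qed.

Lemma le_geometric_eq0 (x C : R) : (forall n, `|x| <= C * (1 / 2) ^+ n) -> x = 0.
Proof.
move=> H; apply/normr0_eq0/le_anti; rewrite normr_ge0 andbT.
have h1 : geometric C (1 / 2) @ \oo --> (0 : R).
  by apply: cvg_geometric; rewrite ger0_norm; lra.
rewrite -(cvg_lim _ h1) //; apply: limr_ge; first by apply/cvg_ex; exists 0.
by apply: nearW => n; apply: H.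
Qed.

Lemma has_ps_inj a f g : has_ps a f -> has_ps a g -> \forall x \near (0 : R), f x = g x.
Proof.
move=> Hf Hg; have [M [B [M0 B0 _ _ H]]] := has_ps_pair Hf Hg.
near=> x.
have : (2 * M) * `|x| <= 1 by near: x; apply: small_near; lra.
move=> Hx; have Mx : M * `|x| <= 1 / 2 by lra.
have M1 : M * `|x| <= 1 by lra.
apply/eqP; rewrite -subr_eq0; apply/eqP; apply: (@le_geometric_eq0 _ (B + B)) => n.
have [h1 h2] := H n x M1.
have -> : f x - g x = (f x - psum a n x) - (g x - psum a n x) by ring.
apply: le_trans (ler_normB _ _) _; rewrite mulrDl.
have : (M * `|x|) ^+ n <= (1 / 2) ^+ n.
  rewrite lerXn2r // nnegrE ?mulr_ge0 // ltW //.
by move=> h; apply: lerD; [apply: le_trans h1 _|apply: le_trans h2 _]; rewrite ler_wpM2l.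
Unshelve. all: by end_near.
Qed.

(** * Order of vanishing at 0 *)

Lemma has_ps_factor a f m : has_ps a f -> (forall k, (k < m)%N -> a k = 0) ->
  exists2 g, has_ps (fun k => a (m + k)%N) g & forall x, f x = x ^+ m * g x.
Proof.
move=> Hf am; have f0 := has_ps0 Hf.
have [M [B [M0 B0 H']]] := has_ps_bounds Hf; have [//|//|Ha H] := H' M B.
(* At 0 the quotient is completed by its limit, the coefficient [a m]. *)
exists (fun x => if x == 0 then a m else f x / x ^+ m); last first.
  move=> x; case: eqP => [->|/eqP x0].
    by rewrite f0; case: (m) am => [|m'] am; rewrite ?mul1r // expr0n mul0r am.
  by rewrite mulrC divfK // expf_neq0.
have BM : B <= B * M ^+ m + B by rewrite lerDr mulr_ge0 // exprn_ge0 // ltW.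
exists M, (B * M ^+ m + B); split=> //.
  by rewrite addr_ge0 // mulr_ge0 // exprn_ge0 // ltW.
move=> n x Hx; case: eqP => [->|/eqP x0].
  rewrite normr0 mulr0; case: n => [|n].
    rewrite /psum big_ord0 subr0 expr0 mulr1.
    by apply: le_trans (Ha m) _; rewrite lerDl.
  rewrite /psum big_ord_recl addn0 expr0 mulr1 big1 ?addr0 ?subrr ?normr0.
    by rewrite expr0n mulr0.
  by move=> i _; rewrite expr0n mulr0.
have xp : 0 < `|x| by rewrite normr_gt0.
have xmp : 0 < `|x| ^+ m by rewrite exprn_gt0.
have E : psum a (m + n) x = x ^+ m * psum (fun k => a (m + k)%N) n x.
  rewrite /psum big_split_ord /= big1 ?add0r; last by move=> i _; rewrite am // mul0r.
  rewrite mulr_sumr; apply: eq_bigr => i _; rewrite exprD; ring.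
have -> : f x / x ^+ m - psum (fun k => a (m + k)%N) n x = (f x - psum a (m + n) x) / x ^+ m.
  by rewrite E mulrBl [X in _ = _ - X]mulrAC divff ?mul1r // expf_neq0.
rewrite normrM normfV normrX ler_pdivrMr //.
apply: le_trans (H _ _ Hx) _; rewrite exprD {1}exprMn.
have -> : B * (M ^+ m * `|x| ^+ m * (M * `|x|) ^+ n) = B * M ^+ m * ((M * `|x|) ^+ n * `|x| ^+ m) by ring.
rewrite -[X in _ <= X]mulrA ler_wpM2r ?lerDl //.
by rewrite mulr_ge0 // ?exprn_ge0 // mulr_ge0 // ltW.
Qed.

(** [m] is the least index of a nonzero coefficient. The factorization holds for every [x], not only
    near 0, which later allows a power of [h] to be taken out of a branch on the whole line. *)
Lemma analytic0_order f : analytic0 f -> (\forall x \near (0 : R), f x = 0) \/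
  exists m g, [/\ analytic0 g, g 0 != 0 & forall x, f x = x ^+ m * g x].
Proof.
case=> a Ha; case: (pselect (exists k, a k != 0)) => [ex|nex]; last first.
  left; apply: has_ps_inj Ha _; apply: has_ps_coef (has_ps_cst 0) => k.
  by apply/eqP; rewrite eq_sym; case: k => [|k]; apply: contra_notT nex => h; exists 0%N + exists k.+1.
right; case: (ex_minnP ex) => m am mmin.
have [|g Hg fg] := has_ps_factor Ha (m := m).
  by move=> k km; apply/eqP; apply: contraLR km => /mmin; rewrite -leqNgt.
exists m, g; split=> //; first by eexists; apply: Hg.
by rewrite (has_ps0 Hg) addn0.
Qed.

Lemma analytic0_zero_or_isolated f : analytic0 f -> (\forall x \near (0 : R), f x = 0) \/
  (\forall x \near (0 : R), x != 0 -> f x != 0).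
Proof.
move=> /analytic0_order[|[m [g [Hg g0 fg]]]]; [by left|right].
apply: filterS (analytic0_near_neq0 Hg g0) => x gx x0.
by rewrite fg mulf_neq0 // expf_neq0.
Qed.

(** If the order [p] of [f] were less than [m], then [|u x| <= C * |x| ^+ (m - p)] would tend to 0,
    against [u 0 != 0]. *)
Lemma analytic0_divX f m (C : R) : analytic0 f ->
  (\forall x \near (0 : R), x != 0 -> `|f x| <= C * `|x| ^+ m) ->
  exists2 g, analytic0 g & \forall x \near (0 : R), f x = x ^+ m * g x.
Proof.
move=> /analytic0_order[f0 _|[p [u [Hu u0 fu]]] HC].
  exists (fun _ => 0); first exact: analytic0_cst.
  by apply: filterS f0 => x ->; rewrite mulr0.
have [mp|pm] := leqP m p.
  exists (fun x => x ^+ (p - m) * u x); first by apply: analytic0M => //; apply: analytic0X analytic0_id.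
  by apply: filterS filterT => x _; rewrite mulrA -exprD subnKC.
exfalso.
have up : 0 < `|u 0| by rewrite normr_gt0.
(* At such a point [|u x| > |u 0| / 2], while the last condition keeps [|C| * |x|] at most
   [|u 0| / 2]. *)
have : \forall x \near (0 : R), [/\ `|u 0 - u x| < `|u 0| / 2, x != 0 -> `|f x| <= C * `|x| ^+ m,
    1 * `|x| <= 1 & (`|C| + 1) * 2 / `|u 0| * `|x| <= 1].
  near=> x; split; near: x.
  - by move/cvgrPdist_lt : (analytic0_continuous Hu); apply; rewrite divr_gt0.
  - exact: HC.
  - exact: small_near.
  - by apply: small_near; rewrite divr_gt0 // mulr_gt0 // ltr_wpDl.
move=> /near0_pos[x [x0 [h1 h2 h3 h4] _]].
move: h2; rewrite gt_eqF // fu normrM normrX => /(_ isT).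
have xn : 0 < `|x| by rewrite normr_gt0 gt_eqF.
rewrite -(subnKC (ltnW pm)) exprD mulrCA ler_pM2l ?exprn_gt0 //.
apply/negP; rewrite -ltNge.
have xs : `|x| ^+ (m - p) <= `|x|.
  rewrite -[X in _ <= X]expr1 ler_wiXn2l //; [lra|lia].
have : C * `|x| ^+ (m - p) <= `|C| * `|x|.
  apply: le_trans (ler_norm _) _; rewrite normrM ler_wpM2l // ger0_norm //.
move: h4; rewrite mulrAC ler_pdivrMr // mul1r => h4.
have := ler_distD (u x) (u 0) 0; rewrite !subr0.
lra.
Unshelve. all: by end_near.
Qed.

(** Near 0 the factor [u] keeps the sign of [u 0], so for odd [p] the values of [f] at [x] and [- x]
    would have opposite signs. *)
Lemma analytic0_nonneg_even_order (f u : R -> R) p : analytic0 u -> u 0 != 0 ->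
  (forall x, f x = x ^+ p * u x) -> (\forall x \near (0 : R), 0 <= f x) -> ~~ odd p.
Proof.
move=> Hu u0 fu f0.
have ueps : \forall h \near (0 : R), `|u 0 - u h| < `|u 0|.
  by move/cvgrPdist_lt : (analytic0_continuous Hu); apply; rewrite normr_gt0.
have [x [x0 [h1 h2] [h3 h4]]] := near0_pos (filterI f0 ueps); apply/negP => op.
move: h1 h3; rewrite !fu exprNn -signr_odd op expr1 mulN1r mulNr oppr_ge0.
have xp : 0 < x ^+ p by rewrite exprn_gt0.
rewrite pmulr_rge0 // pmulr_rle0 // => h1 h3.
move: h2 h4 u0; rewrite !ltr_norml; case: (ler0P (u 0)) => ?; rewrite ?ler0_norm ?gtr0_norm //; lra.
Qed.

(** * Convergence and change of centre *)

Lemma cvg_dist_le (u : nat -> R) (l c b : R) : u @ \oo --> l ->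
  (\forall N \near \oo, `|u N - c| <= b) -> `|l - c| <= b.
Proof.
move=> ul H.
have cv : (fun N => `|u N - c|) @ \oo --> `|l - c|.
  by apply: cvg_norm; apply: cvgB => //; apply: cvg_cst.
rewrite -(cvg_lim _ cv) //; apply: limr_le => //.
by apply/cvg_ex; exists `|l - c|.
Qed.

Lemma has_ps_cvg a f : has_ps a f -> exists2 e, 0 < e & forall x, `|x| < e ->
  series (fun k => a k * x ^+ k) @ \oo --> f x.
Proof.
case=> M [B [M0 B0 H]]; exists M^-1; first by rewrite invr_gt0.
move=> x Hx; have Mx : M * `|x| < 1 by rewrite -ltr_pdivlMl // mulr1.
have h : geometric B (M * `|x|) @ \oo --> (0 : R).
  by apply: cvg_geometric; rewrite ger0_norm // mulr_ge0 // ltW.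
apply/cvgrPdist_le => e e0.
move/cvgrPdist_le : h => /(_ e e0); apply: filterS => n.
rewrite sub0r normrN => hn.
rewrite /series /= big_mkord; apply: le_trans (H n x (ltW Mx)) _.
by apply: le_trans hn; apply: ler_norm.
Qed.

Lemma is_cvg_series_geom_bound (u : nat -> R) C :
  (forall k, `|u k| <= C * (1 / 2) ^+ k) -> cvgn (series u).
Proof.
move=> Hu; apply: normed_cvg.
apply: (@series_le_cvg _ _ (geometric C (1 / 2))) => // [n|n|].
- exact: normr_ge0.
- by apply: le_trans (Hu n).
- by apply: is_cvg_geometric_series; rewrite ger0_norm; lra.
Qed.

(** Replacing [M] by [2 * M] makes the ratio [t] at most 1/2, so that every tail is at most twice
    the bound of its first term. *)
Lemma has_ps_exists a B M : 0 < M -> (forall k, `|a k| <= B * M ^+ k) -> exists f, has_ps a f.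
Proof.
move=> M0 Ha; exists (fun x => limn (series (fun k => a k * x ^+ k))).
have B0 : 0 <= B by have := Ha 0%N; rewrite expr0 mulr1; apply: le_trans.
exists (2 * M), (2 * B); split; rewrite ?mulr_gt0 ?mulr_ge0 //.
move=> n x Hx; set t := M * `|x|.
have t0 : 0 <= t by rewrite mulr_ge0 // ltW.
have t1 : t <= 1 / 2 by move: Hx; rewrite -mulrA -/t; lra.
have bnd k : `|a k * x ^+ k| <= B * t ^+ k.
  by rewrite normrM normrX exprMn mulrA ler_wpM2r // exprn_ge0.
apply: (@cvg_dist_le (series (fun k => a k * x ^+ k))).
  apply: (@is_cvg_series_geom_bound _ B) => k; apply: le_trans (bnd k) _.
  by rewrite ler_wpM2l // lerXn2r // nnegrE //; lra.
exists n => // N /= nN; rewrite /series /= /psum -(subnKC nN) big_mkord big_split_ord /=.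
rewrite addrAC subrr add0r; apply: le_trans (ler_norm_sum _ _ _) _.
apply: (@le_trans _ _ (\sum_(i < N - n) B * t ^+ n * t ^+ i)).
  by apply: ler_sum => i _; rewrite -mulrA -exprD; apply: bnd.
rewrite -mulr_sumr; have -> : 2 * M * `|x| = 2 * t by rewrite /t mulrA.
have Bt : 0 <= B * t ^+ n by rewrite mulr_ge0 // exprn_ge0.
apply: le_trans (ler_wpM2l Bt (geom_sum_le2 _ t0 t1)) _.
have : 1 <= (2 : R) ^+ n by apply: exprn_ege1; lra.
move=> /(ler_wpM2l Bt); rewrite [(2 * t) ^+ n]exprMn.
have -> : 2 * B * (2 ^+ n * t ^+ n) = 2 * (B * t ^+ n * 2 ^+ n) by ring.
set u := B * t ^+ n * 2 ^+ n; lra.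
Qed.

(* Subtracting the terms of degree < n of the binomial expansion leaves a tail
   in which each power y^j, j >= n, is at most (|y|/s)^n s^j. *)
Lemma binomial_tail (d y s : R) k n : 0 < s -> `|y| <= s ->
  `|(d + y) ^+ k - \sum_(j < n) d ^+ (k - j) * y ^+ j *+ 'C(k, j)|
    <= (`|y| / s) ^+ n * (`|d| + s) ^+ k.
Proof.
move=> s0 ys.
have ext (u v : R) : (u + v) ^+ k = \sum_(j < n + k.+1) u ^+ (k - j) * v ^+ j *+ 'C(k, j).
  rewrite exprDn addnC big_split_ord /= [X in _ = _ + X]big1 ?addr0 // => i _.
  by rewrite bin_small ?mulr0n // ltn_addr.
rewrite !ext big_split_ord /= addrAC subrr add0r.
apply: le_trans (ler_norm_sum _ _ _) _.
rewrite big_split_ord /= mulrDr -[X in X <= _]add0r; apply: lerD.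
  rewrite mulr_ge0 ?exprn_ge0 ?divr_ge0 ?(ltW s0) //; apply: sumr_ge0 => i _.
  by rewrite mulrn_wge0 // mulr_ge0 // exprn_ge0 // ltW.
rewrite mulr_sumr; apply: ler_sum => i _.
rewrite normrMn normrM !normrX mulrnAr lerMn2r; apply/orP; right.
rewrite mulrCA ler_wpM2l ?exprn_ge0 //.
rewrite !exprD mulrA -exprMn divfK ?gt_eqF // ler_wpM2l ?exprn_ge0 //.
by rewrite lerXn2r // nnegrE ltW.
Qed.

(** Each [(d + y) ^+ k] is expanded by the binomial formula and the double series is summed over [k]
    first. [binomial_tail] bounds the remainder of every term geometrically in [k], which justifies
    the exchange. *)
Lemma analytic0_recenter f : analytic0 f -> \forall d \near (0 : R), analytic0 (fun y => f (d + y)).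
Proof.
case=> a Ha; have [e e0 Hcv] := has_ps_cvg Ha.
case: (has_ps_bounds Ha) => M [B [M0 B0]] /(_ (M + 1 / e) B).
have e'0 : 0 < 1 / e by rewrite divr_gt0.
case=> // [|Hb _]; first lra.
set M' := M + 1 / e in Hb; have M'0 : 0 < M' by rewrite /M'; lra.
(* With [|d|] and [|y|] at most [s], [M' * (|d| + s) <= 1 / 2] gives geometric decay in [k], and the
   summand [1 / e] of [M'] keeps [d + y] within the radius of convergence [e]. *)
pose s := (4 * M')^-1; have s0 : 0 < s by rewrite invr_gt0; lra.
have Ms : M' * s = 1 / 4 by rewrite /s; field; rewrite gt_eqF.
have se : s < e / 2.
  have : M' * s * e = e / 4 by rewrite Ms; lra.
  have -> : M' * s * e = M * s * e + s by rewrite /M'; field; rewrite gt_eqF.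
  have : 0 < M * s * e by rewrite !mulr_gt0.
  lra.
near=> d.
have ds : `|d| <= s.
  have : s^-1 * `|d| <= 1 by near: d; apply: small_near; rewrite invr_gt0.
  by rewrite mulrC ler_pdivrMr // mul1r.
pose u j k := a k * (d ^+ (k - j) *+ 'C(k, j)).
have bu k n (y : R) : `|y| <= s ->
    `|a k * (d + y) ^+ k - \sum_(j < n) u j k * y ^+ j| <= B * (`|y| / s) ^+ n * (1 / 2) ^+ k.
  move=> ys.
  have -> : a k * (d + y) ^+ k - \sum_(j < n) u j k * y ^+ j =
      a k * ((d + y) ^+ k - \sum_(j < n) d ^+ (k - j) * y ^+ j *+ 'C(k, j)).
    rewrite mulrBr mulr_sumr; congr (_ - _); apply: eq_bigr => j _.
    by rewrite /u -mulrA mulrnAl.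
  rewrite normrM; apply: (@le_trans _ _ (B * M' ^+ k * ((`|y| / s) ^+ n * (`|d| + s) ^+ k))).
    by apply: ler_pM => //; apply: binomial_tail.
  have -> : B * M' ^+ k * ((`|y| / s) ^+ n * (`|d| + s) ^+ k) =
     B * (`|y| / s) ^+ n * (M' * (`|d| + s)) ^+ k by rewrite [(M' * _) ^+ k]exprMn; ring.
  rewrite ler_wpM2l //.
    by rewrite mulr_ge0 // exprn_ge0 // divr_ge0 // ltW.
  have h0 : 0 <= M' * (`|d| + s) by rewrite mulr_ge0 ?addr_ge0 // ltW.
  have h1 : M' * (`|d| + s) <= 1 / 2.
    have : M' * (`|d| + s) <= M' * (s + s) by rewrite ler_wpM2l ?(ltW M'0) // lerD2r.
    by rewrite mulrDr [M' * (s + s)]mulrDr Ms; lra.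
  by rewrite lerXn2r // nnegrE; lra.
(* The term of degree [j] is the difference of the truncations at [j] and [j.+1]; evaluating at
   [y = s] bounds [u j k] geometrically in [k]. *)
have cu j : cvgn (series (u j)).
  have c1 : `|s| <= s by rewrite gtr0_norm.
  apply: (@is_cvg_series_geom_bound _ ((B * (`|s| / s) ^+ j + B * (`|s| / s) ^+ j.+1) / s ^+ j)) => k.
  have h1 := bu k j s c1; have h2 := bu k j.+1 s c1.
  rewrite big_ord_recr /= in h2.
  have : `|u j k * s ^+ j| <= (B * (`|s| / s) ^+ j + B * (`|s| / s) ^+ j.+1) * (1 / 2) ^+ k.
    by move: h1 h2; rewrite !ler_norml; lra.
  rewrite normrM (gtr0_norm (exprn_gt0 j s0)) -ler_pdivlMr ?exprn_gt0 //.
  by rewrite mulrAC.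
exists (fun j => limn (series (u j))), s^-1, (2 * B).
split; [by rewrite invr_gt0|by rewrite mulr_ge0|move=> n y ys].
have {}ys : `|y| <= s by rewrite -(mulr1 s) -ler_pdivrMl.
have cdy : series (fun k => a k * (d + y) ^+ k) @ \oo --> f (d + y).
  apply: Hcv; apply: le_lt_trans (ler_normD _ _) _; lra.
have cps : (fun N => \sum_(j < n) series (u j) N * y ^+ j) @ \oo -->
    psum (fun j => limn (series (u j))) n y.
  rewrite /psum; elim: (n) => [|m IHm].
    under eq_fun do rewrite big_ord0; rewrite big_ord0; exact: cvg_cst.
  under eq_fun do rewrite big_ord_recr /=; rewrite big_ord_recr /=.
  by apply: cvgD => //; apply: cvgM; [exact: cu|exact: cvg_cst].
have cd := cvgB cdy cps.
have := @cvg_dist_le _ _ 0 (2 * B * (s^-1 * `|y|) ^+ n) (cd _); rewrite subr0; apply.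
apply: filterS filterT => N _; rewrite subr0 !fctE /series /=.
have -> : \sum_(0 <= k < N) a k * (d + y) ^+ k - \sum_(j < n) (\sum_(0 <= k < N) u j k) * y ^+ j
   = \sum_(0 <= k < N) (a k * (d + y) ^+ k - \sum_(j < n) u j k * y ^+ j).
  rewrite [RHS]sumrB; congr (_ - _); rewrite exchange_big /=.
  by apply: eq_bigr => j _; rewrite mulr_suml.
rewrite big_mkord; apply: le_trans (ler_norm_sum _ _ _) _.
apply: (@le_trans _ _ (\sum_(k < N) B * (`|y| / s) ^+ n * (1 / 2) ^+ k)).
  by apply: ler_sum => k _; apply: bu.
rewrite -mulr_sumr.
have -> : 2 * B * (s^-1 * `|y|) ^+ n = B * (`|y| / s) ^+ n * 2.
  by rewrite [s^-1 * _]mulrC; set v := _ ^+ n; ring.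
apply: ler_wpM2l; last by apply: geom_sum_le2; lra.
by rewrite mulr_ge0 // exprn_ge0 // divr_ge0 // ltW.
Unshelve. all: by end_near.
Qed.

End PowerSeries.

(** * Quadratic systems over analytic germs *)

Section QuadFix.
Variable R : realType.

(** When constant terms vanish, the degree [n] coefficient of a product involves only smaller
    degrees of each factor; this drives the stabilisation in [quad_fix]. *)
Lemma inner_index_lt p n m : (0 < p)%N -> p != n -> (p < n.+1)%N -> (n < m.+1)%N ->
  (p < m)%N /\ (n - p < m)%N.
Proof. lia. Qed.

Lemma has_psZ (a : nat -> R) f c : has_ps a f -> has_ps (fun k => c * a k) (fun x => c * f x).
Proof.
move=> Hf; apply: has_ps_coef (has_psM (has_ps_cst c) Hf) => k.
by rewrite big_ord_recl /= subn0 big1 ?addr0 // => i _; rewrite mul0r.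
Qed.

Lemma has_ps_sum (I : Type) (r : seq I) (a : I -> nat -> R) (f : I -> R -> R) :
  (forall i, has_ps (a i) (f i)) ->
  has_ps (fun k => \sum_(i <- r) a i k) (fun x => \sum_(i <- r) f i x).
Proof.
move=> H; elim: r => [|i r IHr].
  apply: has_ps_ext (has_ps_coef _ (has_ps_cst 0)) => [|k]; last by rewrite big_nil; case: k.
  by apply: filterS filterT => x _; rewrite big_nil.
apply: has_ps_ext (has_ps_coef _ (has_psD (H i) IHr)) => [|k]; last by rewrite big_cons.
by apply: filterS filterT => x _; rewrite big_cons.
Qed.

Variables (N : nat) (bet : 'I_N -> 'I_N -> 'I_N -> R).

Definition quadF (c : 'I_N -> nat -> R) (z : 'I_N -> nat -> R) i n :=
  c i n + \sum_j \sum_k bet i j k * \sum_(p < n.+1) z j p * z k (n - p)%N.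

Definition wnorm (r : R) L (z : 'I_N -> nat -> R) := \sum_i psum (fun n => `|z i n|) L r.

Lemma psum_abs_ge0 (z : nat -> R) L r : 0 <= r -> 0 <= psum (fun n => `|z n|) L r.
Proof. by move=> r0; apply: sumr_ge0 => i _; rewrite mulr_ge0 // exprn_ge0. Qed.

Lemma psum_le_wnorm r L z i : 0 <= r -> psum (fun n => `|z i n|) L r <= wnorm r L z.
Proof.
move=> r0; rewrite /wnorm (bigD1 i) //= lerDl; apply: sumr_ge0 => j _.
exact: psum_abs_ge0.
Qed.

Lemma psum_leL (z : nat -> R) L L' r : 0 <= r -> (L <= L')%N ->
  psum (fun n => `|z n|) L r <= psum (fun n => `|z n|) L' r.
Proof.
move=> r0 LL; rewrite /psum -(subnKC LL) big_split_ord /= lerDl.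
by apply: sumr_ge0 => i _; rewrite mulr_ge0 // exprn_ge0.
Qed.

(** The weighted l1 norm is submultiplicative for Cauchy products. Truncation at [L] keeps all sums
    finite, so no convergence is presupposed. *)
Lemma wnorm_quadF r L c z : 0 <= r ->
  wnorm r L (quadF c z) <= wnorm r L c + (\sum_i \sum_j \sum_k `|bet i j k|) * wnorm r L z ^+ 2.
Proof.
move=> r0; rewrite /wnorm mulr_suml -big_split; apply: ler_sum => i _ /=.
rewrite -/(wnorm r L z).
pose conv j k m := \sum_(p < m.+1) `|z j p| * `|z k (m - p)%N|.
apply: (@le_trans _ _ (psum (fun n => `|c i n|) L r +
    \sum_j \sum_k `|bet i j k| * psum (conv j k) L r)).
  rewrite /psum.
  under [X in _ + X]eq_bigr do under eq_bigr do rewrite mulr_sumr.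
  under [X in _ + X]eq_bigr do rewrite exchange_big.
  rewrite [X in _ + X]exchange_big -big_split; apply: ler_sum => n _ /=.
  under eq_bigr do under eq_bigr do rewrite mulrA.
  under eq_bigr do rewrite -mulr_suml.
  rewrite -mulr_suml -mulrDl; apply: ler_wpM2r; first exact: exprn_ge0.
  apply: le_trans (ler_normD _ _) _; rewrite lerD2l.
  apply: le_trans (ler_norm_sum _ _ _) _; apply: ler_sum => j _.
  apply: le_trans (ler_norm_sum _ _ _) _; apply: ler_sum => k _.
  rewrite normrM ler_wpM2l //.
  apply: le_trans (ler_norm_sum _ _ _) _; apply: ler_sum => p _.
  by rewrite normrM.
rewrite lerD2l mulr_suml; apply: ler_sum => j _.
rewrite mulr_suml; apply: ler_sum => k _; apply: ler_wpM2l => //.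
rewrite /conv (psumM (fun p => `|z j p|) (fun p => `|z k p|)).
apply: (@le_trans _ _ (\sum_(p < L) `|z j p| * r ^+ p * wnorm r L z)).
  apply: ler_sum => p _; apply: ler_wpM2l; first by rewrite mulr_ge0 // exprn_ge0.
  apply: le_trans (psum_le_wnorm _ _ k r0); apply: psum_leL => //.
  exact: leq_subr.
rewrite -mulr_suml expr2; apply: ler_wpM2r; last exact: psum_le_wnorm.
by apply: sumr_ge0 => l _; apply: psum_abs_ge0.
Qed.

(** The vanishing constant terms give a factor [r]: the norm of the data becomes small with the
    radius, uniformly in [L]. *)
Lemma wnorm_small (c : 'I_N -> nat -> R) B M : 0 < M -> 0 <= B ->
  (forall i k, `|c i k| <= B * M ^+ k) -> (forall i, c i 0%N = 0) ->
  forall r, 0 <= r -> M * r <= 1 / 2 -> forall L, wnorm r L c <= r * (N%:R * (2 * B * M)).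
Proof.
move=> M0 B0 Hc c0 r r0 Mr L; rewrite /wnorm.
apply: (@le_trans _ _ (\sum_(i < N) r * (2 * B * M))); last first.
  by rewrite sumr_const card_ord -[X in X <= _]mulr_natl mulrCA.
apply: ler_sum => i _; rewrite /psum.
case: L => [|L]; first by rewrite big_ord0 !mulr_ge0 // ltW.
rewrite big_ord_recl c0 normr0 mul0r add0r.
apply: (@le_trans _ _ (\sum_(n < L) B * M * r * (M * r) ^+ n)).
  apply: ler_sum => n _ /=; rewrite /bump /= add1n.
  have -> : B * M * r * (M * r) ^+ n = B * M ^+ n.+1 * r ^+ n.+1.
    by rewrite exprMn !exprS; set u := _ ^+ n; set v := _ ^+ n; ring.
  by apply: ler_wpM2r => //; apply: exprn_ge0.
rewrite -mulr_sumr; have Mr0 : 0 <= M * r by rewrite mulr_ge0 // ltW.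
have BMr : 0 <= B * M * r by rewrite !mulr_ge0 // ltW.
by have := ler_wpM2l BMr (geom_sum_le2 L Mr0 Mr); lra.
Qed.

(* The coefficients of the solution are the limit of the iterates of [quadF]
   from 0, which stabilise degree by degree; a truncated weighted l1 norm stays
   bounded along the iteration. *)
Lemma quad_fix (c : 'I_N -> R -> R) :
  (forall i, analytic0 (c i)) -> (forall i, c i 0 = 0) ->
  exists z : 'I_N -> R -> R, [/\ forall i, analytic0 (z i), forall i, z i 0 = 0 &
   \forall h \near (0 : R), forall i,
     z i h = c i h + \sum_j \sum_k bet i j k * (z j h * z k h)].
Proof.
move=> Hc c0; have [cc Hcc] := choice Hc.
have cc0 i : cc i 0%N = 0 by rewrite -(has_ps0 (Hcc i)).
have [M [B [M0 B0 Hb]]] : exists M B, [/\ 0 < M, 0 <= B & forall i k, `|cc i k| <= B * M ^+ k].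
  have /choice[F HF] : forall i, exists MB : R * R, [/\ 0 < MB.1, 0 <= MB.2 &
    forall M' B', MB.1 <= M' -> MB.2 <= B' -> forall k, `|cc i k| <= B' * M' ^+ k].
    move=> i; have [M [B [M0 B0 H]]] := has_ps_bounds (Hcc i).
    by exists (M, B); split=> // M' B' h1 h2; have [] := H M' B' h1 h2.
  have S1 : 0 <= \sum_i (F i).1 by apply: sumr_ge0 => i _; have [/ltW] := HF i.
  exists (1 + \sum_i (F i).1), (\sum_i (F i).2); split.
  - by rewrite ltr_pwDl.
  - by apply: sumr_ge0 => i _; have [] := HF i.
  move=> i; have [_ _] := HF i; apply.
    rewrite (bigD1 i) //= addrCA lerDl addr_ge0 //.
    by apply: sumr_ge0 => j _; have [/ltW] := HF j.
  rewrite (bigD1 i) //= lerDl; apply: sumr_ge0 => j _; by have [] := HF j.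
pose K := \sum_i \sum_j \sum_k `|bet i j k|.
have K0 : 0 <= K by do 3 (apply: sumr_ge0 => ? _).
pose D := N%:R * (2 * B * M).
have D0 : 0 <= D by rewrite !mulr_ge0 // ltW.
have KD : 0 <= K * D by rewrite mulr_ge0.
(* This radius gives [M * r <= 1 / 2] and [4 * K * r * D <= 1]. The second makes the ball of radius
   [2 * r * D] invariant, since [r * D + K * (2 * r * D) ^+ 2 <= 2 * r * D]. *)
pose r := (2 * M + 4 * (K * D))^-1.
have r0 : 0 < r by rewrite invr_gt0; lra.
have rE : r * (2 * M + 4 * (K * D)) = 1 by rewrite mulVf // gt_eqF //; lra.
have rM0 : 0 < r * M by rewrite mulr_gt0.
have rKD : 0 <= r * (K * D) by rewrite mulr_ge0 // ltW.
have rM : M * r <= 1 / 2 by lra.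
have rC : 4 * (K * (r * D)) <= 1 by lra.
have rD : 0 <= r * D by rewrite mulr_ge0 // ltW.
pose Z m := iter m (quadF cc) (fun _ _ => 0).
have Z0 m i : Z m i 0%N = 0.
  elim: m i => // m IHm i; rewrite /Z iterS -/(Z m) /quadF cc0 add0r.
  by rewrite big1 // => j _; rewrite big1 // => k _; rewrite big_ord1 IHm mul0r mulr0.
have ZS m : forall i n, (n < m)%N -> Z m.+1 i n = Z m i n.
  elim: m => // m IHm i n nm; change (quadF cc (Z m.+1) i n = quadF cc (Z m) i n); rewrite /quadF.
  congr (_ + _); apply: eq_bigr => j _; apply: eq_bigr => k _; congr (_ * _).
  apply: eq_bigr => p _; have [p0|p0] := posnP p.
    by rewrite p0 !Z0 !mul0r.
  have [pn|pn] := eqVneq (p : nat) n; first by rewrite pn subnn !Z0 !mulr0.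
  by have [pm npm] := inner_index_lt p0 pn (ltn_ord p) nm; rewrite !IHm.
have Zst m i n : (n < m)%N -> Z m i n = Z n.+1 i n.
  by move=> /subnK <-; elim: (m - n.+1)%N => // q IHq; rewrite addSn ZS // leq_addl.
have ZB L m : wnorm r L (Z m) <= 2 * (r * D).
  elim: m => [|m IHm].
    rewrite /wnorm big1 => [|i _]; first by apply: mulr_ge0.
    by rewrite /psum big1 // => n _; rewrite normr0 mul0r.
  rewrite /Z iterS -/(Z m); apply: le_trans (wnorm_quadF _ _ _ (ltW r0)) _; rewrite -/K.
  have h1 := wnorm_small M0 B0 Hb cc0 (ltW r0) rM L.
  have W0 : 0 <= wnorm r L (Z m) by apply: sumr_ge0 => i _; apply: psum_abs_ge0; exact: ltW.
  have : K * wnorm r L (Z m) ^+ 2 <= K * (2 * (r * D)) ^+ 2.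
    by apply: ler_wpM2l => //; rewrite lerXn2r // nnegrE mulr_ge0.
  have : 4 * (K * (r * D)) * (r * D) <= 1 * (r * D) by apply: ler_wpM2r.
  rewrite -/D in h1; rewrite !expr2; set w := wnorm _ _ _ in h1 *; lra.
(* By [Zst] the coefficient of degree [n] no longer changes after [n.+1] iterations. *)
pose zc i n := Z n.+1 i n.
have zcE i n : zc i n = quadF cc zc i n.
  change (quadF cc (Z n) i n = quadF cc zc i n); rewrite /quadF; congr (_ + _).
  apply: eq_bigr => j _; apply: eq_bigr => k _; congr (_ * _).
  apply: eq_bigr => p _; rewrite /zc; have [p0|p0] := posnP p.
    by rewrite p0 !Z0 !mul0r.
  have [pn|pn] := eqVneq (p : nat) n; first by rewrite pn subnn !Z0 !mulr0.
  by have [pm npm] := inner_index_lt p0 pn (ltn_ord p) (ltnSn n); rewrite !(@Zst n).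
have zcb i n : `|zc i n| <= 2 * (r * D) * r^-1 ^+ n.
  rewrite exprVn ler_pdivlMr ?exprn_gt0 //.
  apply: le_trans (ZB n.+1 n.+1); apply: le_trans (psum_le_wnorm _ _ i (ltW r0)).
  rewrite psumS /zc lerDr; apply: psum_abs_ge0; exact: ltW.
have /choice[z Hz] i := has_ps_exists (a := zc i) (M := r^-1) ltac:(by rewrite invr_gt0) (zcb i).
exists z; split=> [i|i|]; first by exists (zc i).
  by rewrite (has_ps0 (Hz i)) /zc Z0.
suff H i : \forall h \near (0 : R), z i h = c i h + \sum_j \sum_k bet i j k * (z j h * z k h).
  exact: (filter_forall _ H).
apply: has_ps_inj (Hz i) _.
apply: (@has_ps_coef _ (quadF cc zc i)) => [n|]; first by rewrite -zcE.
apply: has_psD => //; apply: has_ps_sum => j; apply: has_ps_sum => k.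
by apply: has_psZ; apply: has_psM.
Qed.

End QuadFix.

(** * Hensel's lemma for analytic families of polynomials *)

Section Hensel.
Variable R : realType.
Implicit Types (P Q : R -> {poly R}).

Definition analytic0p P := forall k, analytic0 (fun h => (P h)`_k).

Lemma analytic0p_eq P Q : P =1 Q -> analytic0p P -> analytic0p Q.
Proof. by move=> PQ HP k; apply: analytic0_eq (HP k) => x; rewrite PQ. Qed.

Lemma analytic0p_cst p : analytic0p (fun _ => p).
Proof. by move=> k; apply: analytic0_cst. Qed.

Lemma analytic0pC (f : R -> R) : analytic0 f -> analytic0p (fun h => (f h)%:P).
Proof.
move=> Hf k; apply: (analytic0_eq (f := fun h => if k == 0%N then f h else 0)).
  by move=> h; rewrite coefC.
by case: eqP => _ //; apply: analytic0_cst.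
Qed.

Lemma analytic0pD P Q : analytic0p P -> analytic0p Q -> analytic0p (fun h => P h + Q h).
Proof.
move=> HP HQ k; apply: analytic0_eq (analytic0D (HP k) (HQ k)) => h; by rewrite coefD.
Qed.

Lemma analytic0pM P Q : analytic0p P -> analytic0p Q -> analytic0p (fun h => P h * Q h).
Proof.
move=> HP HQ k; apply: (analytic0_eq (f := fun h => \sum_(i < k.+1) (P h)`_i * (Q h)`_(k - i))).
  by move=> h; rewrite coefM.
by apply: analytic0_sum => i _; apply: analytic0M; [apply: HP|apply: HQ].
Qed.

Lemma analytic0p_sum (I : Type) (r : seq I) (A : pred I) (F : I -> R -> {poly R}) :
  (forall i, analytic0p (F i)) -> analytic0p (fun h => \sum_(i <- r | A i) F i h).
Proof.
move=> HF k; apply: (analytic0_eq (f := fun h => \sum_(i <- r | A i) (F i h)`_k)).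
  by move=> h; rewrite coef_sum.
by apply: analytic0_sum => i _; apply: HF.
Qed.

Lemma analytic0p_prod (I : Type) (r : seq I) (A : pred I) (F : I -> R -> {poly R}) :
  (forall i, analytic0p (F i)) -> analytic0p (fun h => \prod_(i <- r | A i) F i h).
Proof.
move=> HF; elim: r => [|i r IHr].
  by apply: analytic0p_eq (analytic0p_cst 1) => h; rewrite big_nil.
case Ai: (A i).
  by apply: analytic0p_eq (analytic0pM (HF i) IHr) => h; rewrite big_cons Ai.
by apply: analytic0p_eq IHr => h; rewrite big_cons Ai.
Qed.

Lemma analytic0p_exp P n : analytic0p P -> analytic0p (fun h => P h ^+ n).
Proof.
move=> HP; apply: analytic0p_eq (analytic0p_prod (index_enum 'I_n) xpredT (fun=> HP)) => h.
by rewrite prodr_const card_ord.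
Qed.

(** Multiply a Bezout relation by [y] and reduce the cofactor of [p2] modulo [p1]; the bound on
    [size y] then limits the degree of the other cofactor. *)
Lemma coprime_decomp (p1 p2 y : {poly R}) : p1 != 0 -> p2 != 0 -> coprimep p1 p2 ->
  (size y < (size p1 + size p2).-1)%N ->
  exists u v : {poly R}, [/\ (size u < size p1)%N, (size v < size p2)%N & u * p2 + v * p1 = y].
Proof.
move=> p10 p20 /Bezout_eq1_coprimepP[[t s] /= ts] sy.
set u := (y * s) %% p1.
have su : (size u < size p1)%N by rewrite ltn_modp.
have dv : p1 %| y - u * p2.
  have -> : u = y * s - (y * s) %/ p1 * p1.
    have E := divp_eq (y * s) p1; rewrite -/u in E; apply/esym.
    by rewrite {1}E [_ + u]addrC addrK.
  have -> : y - (y * s - (y * s) %/ p1 * p1) * p2 = (y * t + (y * s) %/ p1 * p2) * p1.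
    rewrite -{1}[y]mulr1 -ts; ring.
  exact: dvdp_mull.
exists u, ((y - u * p2) %/ p1); split=> //; last by rewrite divpK // addrC subrK.
have : (size (y - u * p2)%R < (size p1 + size p2).-1)%N.
  apply: leq_ltn_trans (size_polyD _ _) _; rewrite size_polyN gtn_max sy /=.
  apply: leq_ltn_trans (size_polyMleq _ _) _.
  clearbody u; clear -su sy; move: (size y) (size u) (size p1) (size p2) su sy => *; lia.
rewrite size_divp //; move: p10 p20; rewrite -!size_poly_gt0.
by move: (size _) (size p1) (size p2) => a b c; lia.
Qed.

Lemma size_sum_lt (I : Type) (r : seq I) (F : I -> {poly R}) m : (0 < m)%N ->
  (forall i, (size (F i) < m)%N) -> (size (\sum_(i <- r) F i)%R < m)%N.
Proof.
move=> m0 HF; apply: (big_ind (fun p : {poly R} => (size p < m)%N)) => //.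
  by rewrite size_poly0.
by move=> p q hp hq; apply: leq_ltn_trans (size_polyD _ _) _; rewrite gtn_max hp.
Qed.

(** Choose [U j * p2 + V j * p1 = 'X^j] and look for factors [p1 + \sum_j z j * U j] and
    [p2 + \sum_j z j * V j] with the same unknowns. Their product is [Q 0 + \sum_j z j * 'X^j] plus
    a quadratic term, so the factorization is a system to which [quad_fix] applies. *)
Lemma hensel Q (p1 p2 : {poly R}) n :
  p1 \is monic -> p2 \is monic -> coprimep p1 p2 ->
  analytic0p Q -> (forall h, Q h \is monic) -> (forall h, size (Q h) = n.+1) ->
  Q 0 = p1 * p2 ->
  exists P1 P2, [/\ analytic0p P1, analytic0p P2,
    forall h, P1 h \is monic /\ size (P1 h) = size p1,
    forall h, P2 h \is monic /\ size (P2 h) = size p2 &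
    \forall h \near (0 : R), Q h = P1 h * P2 h].
Proof.
move=> m1 m2 cop HQ mQ sQ Q0.
have sp : (size p1 + size p2).-1 = n.+1.
  by rewrite -(sQ 0) Q0 size_monicM // monic_neq0.
have /choice[U /choice[V HUV]] : forall i : 'I_n, exists u v : {poly R},
    [/\ (size u < size p1)%N, (size v < size p2)%N & u * p2 + v * p1 = 'X^i].
  move=> i; apply: coprime_decomp => //; [exact: monic_neq0..|].
  rewrite size_polyXn sp ltnS; exact: ltn_ord.
pose c (i : 'I_n) h := (Q h)`_i - (Q 0)`_i.
have [|i|z [Hz z0 zE]] := @quad_fix R n (fun i j k => - (U j * V k)`_i) c.
- by move=> i; apply: analytic0B (HQ i) (analytic0_cst _).
- by rewrite /c subrr.
pose P1 h := p1 + \sum_j (z j h)%:P * U j; pose P2 h := p2 + \sum_j (z j h)%:P * V j.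
have sC (b : R) (p : {poly R}) m : (size p < m)%N -> (size (b%:P * p)%R < m)%N.
  by move=> h; rewrite mul_polyC; apply: leq_ltn_trans (size_scale_leq _ _) h.
have S1 h : (size (\sum_j (z j h)%:P * U j)%R < size p1)%N.
  apply: size_sum_lt => [|j]; first by rewrite size_poly_gt0 monic_neq0.
  by have [? _ _] := HUV j; apply: sC.
have S2 h : (size (\sum_j (z j h)%:P * V j)%R < size p2)%N.
  apply: size_sum_lt => [|j]; first by rewrite size_poly_gt0 monic_neq0.
  by have [_ ? _] := HUV j; apply: sC.
exists P1, P2; split.
- apply: analytic0pD; first exact: analytic0p_cst.
  by apply: analytic0p_sum => j; apply: analytic0pM; [apply: analytic0pC|apply: analytic0p_cst].
- apply: analytic0pD; first exact: analytic0p_cst.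
  by apply: analytic0p_sum => j; apply: analytic0pM; [apply: analytic0pC|apply: analytic0p_cst].
- by move=> h; rewrite /P1 monicE lead_coefDl // -monicE size_polyDl.
- by move=> h; rewrite /P2 monicE lead_coefDl // -monicE size_polyDl.
apply: filterS zE => h zE.
have -> : P1 h * P2 h = Q 0 + \sum_j (z j h)%:P * 'X^j +
    \sum_j \sum_k (z j h * z k h)%:P * (U j * V k).
  rewrite /P1 /P2 mulrDl !mulrDr -Q0 !addrA -addrA -[in RHS]addrA -!addrA; congr (_ + _).
  rewrite addrA; congr (_ + _).
    rewrite mulr_sumr mulr_suml -big_split; apply: eq_bigr => j _ /=.
    by have [_ _ <-] := HUV j; ring.
  rewrite mulr_suml; apply: eq_bigr => j _; rewrite mulr_sumr; apply: eq_bigr => k _.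
  by rewrite polyCM; ring.
apply/polyP => i; rewrite !coefD.
have -> : (\sum_j \sum_k (z j h * z k h)%:P * (U j * V k))`_i =
    \sum_j \sum_k (z j h * z k h) * (U j * V k)`_i.
  by rewrite coef_sum; apply: eq_bigr => j _; rewrite coef_sum; apply: eq_bigr => k _; rewrite coefCM.
(* From degree [n] on both correction sums vanish, and the monic polynomials [Q h] and [Q 0] have
   the same coefficients there. *)
have [ni|ni] := leqP n i.
  rewrite coef_sum !big1 ?addr0.
  - move: ni; rewrite leq_eqVlt => /orP[/eqP<-|ni].
      by have := mQ h; have := mQ 0; rewrite !monicE /lead_coef !sQ /= => /eqP-> /eqP->.
    by rewrite !nth_default ?sQ.
  - move=> j _; rewrite big1 // => k _; rewrite nth_default ?mulr0 //.
    have [s1 _ _] := HUV j; have [_ s2 _] := HUV k.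
    by apply: leq_trans (size_polyMleq _ _) _; lia.
  - by move=> j _; rewrite coefCM coefXn gtn_eqF ?mulr0 // (leq_trans (ltn_ord j)).
have := zE (Ordinal ni); rewrite /c /=.
have -> : (\sum_j (z j h)%:P * 'X^j)`_i = z (Ordinal ni) h.
  rewrite coef_sum (bigD1 (Ordinal ni)) //= coefCM coefXn eqxx mulr1 big1 ?addr0 // => j ji.
  rewrite coefCM coefXn; case: eqP => [ij|]; last by rewrite mulr0.
  by case/negP: ji; apply/eqP/val_inj.
move=> ->.
have -> : \sum_j \sum_k - (U j * V k)`_i * (z j h * z k h) =
    - \sum_j \sum_k (z j h * z k h) * (U j * V k)`_i.
  rewrite -sumrN; apply: eq_bigr => j _; rewrite -sumrN; apply: eq_bigr => k _.
  by rewrite mulNr mulrC.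
ring.
Qed.

End Hensel.

(** * Real-rooted polynomials *)

Section RealRooted.
Variable R : realType.

Definition real_rooted (p : {poly R}) := exists rs : seq R, p = \prod_(r <- rs) ('X - r%:P).

Local Notation C := (complex R).

Lemma real_rootedP (p : {poly R}) : p \is monic ->
  (forall z : C, root (map_poly (real_complex R) p) z -> complex.Im z = 0) -> real_rooted p.
Proof.
move=> pm Hz; have [zs Hzs] := closed_field_poly_normal (map_poly (real_complex R) p).
have lc : lead_coef (map_poly (real_complex R) p) = 1.
  by rewrite lead_coef_map (monicP pm) rmorph1.
rewrite lc scale1r in Hzs.
exists (map (@complex.Re R) zs); apply: (map_poly_inj (real_complex R)).
rewrite Hzs big_map rmorph_prod /=; rewrite !big_seq; apply: eq_bigr => z zin.
rewrite rmorphB /= map_polyX map_polyC /=; congr (_ - _%:P).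
have /Hz : root (map_poly (real_complex R) p) z by rewrite Hzs root_prod_XsubC.
by case: z {zin} => x y /= ->.
Qed.

(** Squared, so that it is polynomial in the real and imaginary parts and therefore stays analytic
    along a family. *)
Definition sqr_modulus (z : C) : R := complex.Re z ^+ 2 + complex.Im z ^+ 2.

Lemma sqr_modulusM z w : sqr_modulus (z * w) = sqr_modulus z * sqr_modulus w.
Proof. by case: z w => [a b] [c d]; rewrite /sqr_modulus /=; ring. Qed.

Lemma sqr_modulus_prod_ge (rs : seq R) (z : C) :
  (complex.Im z ^+ 2) ^+ size rs <= sqr_modulus (map_poly (real_complex R) (\prod_(r <- rs) ('X - r%:P))).[z].
Proof.
elim: rs => [|r rs IH].
  by rewrite big_nil rmorph1 hornerC /sqr_modulus /= expr1n expr0n addr0.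
rewrite [size _]/= exprS big_cons rmorphM hornerM sqr_modulusM; apply: ler_pM => //.
- by rewrite sqr_ge0.
- by rewrite exprn_ge0 // sqr_ge0.
rewrite rmorphB /= map_polyX map_polyC /= hornerXsubC /sqr_modulus.
by case: z {IH} => a b /=; rewrite oppr0 addr0 lerDr sqr_ge0.
Qed.

Lemma ReD (z w : C) : complex.Re (z + w) = complex.Re z + complex.Re w.
Proof. by case: z w => [a b] [c d]. Qed.
Lemma ImD (z w : C) : complex.Im (z + w) = complex.Im z + complex.Im w.
Proof. by case: z w => [a b] [c d]. Qed.

Lemma analytic0_sqr_modulus_horner (P : R -> {poly R}) n (z : C) : analytic0p P -> (forall h, (size (P h) <= n)%N) ->
  analytic0 (fun h => sqr_modulus (map_poly (real_complex R) (P h)).[z]).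
Proof.
move=> HP sP.
pose re h := \sum_(i < n) (P h)`_i * complex.Re (z ^+ i).
pose im h := \sum_(i < n) (P h)`_i * complex.Im (z ^+ i).
have E h : (map_poly (real_complex R) (P h)).[z] = Complex (re h) (im h).
  rewrite (@horner_coef_wide _ n); last by rewrite size_map_poly.
  rewrite /re /im; elim: n {sP re im} => [|n IH]; first by rewrite !big_ord0.
  rewrite !big_ord_recr /= IH coef_map /=; case: (z ^+ n) => a b.
  by apply/eqP; rewrite eq_complex /= !mul0r subr0 addr0 !eqxx.
apply: (analytic0_eq (f := fun h => re h ^+ 2 + im h ^+ 2)); first by move=> h; rewrite E.
by apply: analytic0D; apply: analytic0X; apply: analytic0_sum => i _; apply: analytic0M (analytic0_cst _); apply: HP.
Qed.

(* A product of n factors z - r with real r has modulus at least |Im z|^n, so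
   a limit of real-rooted polynomials does not vanish off the real line. *)
Lemma real_rooted_limit (P : R -> {poly R}) n : analytic0p P ->
  (forall h, P h \is monic) -> (forall h, size (P h) = n.+1) ->
  (\forall h \near (0 : R), h != 0 -> real_rooted (P h)) -> real_rooted (P 0).
Proof.
move=> HP mP sP HH; apply: real_rootedP => // z rz; apply/eqP/negPn/negP => z0.
have cz := analytic0_sqr_modulus_horner (n := n.+1) z HP (fun h => eq_leq (sP h)).
set b := (complex.Im z ^+ 2) ^+ n.
have b0 : 0 < b by rewrite exprn_gt0 // exprn_even_gt0.
have [x [x0 [] ]] : exists x, [/\ 0 < x, (x != 0 -> real_rooted (P x)) /\
    `|sqr_modulus (map_poly (real_complex R) (P 0)).[z] - sqr_modulus (map_poly (real_complex R) (P x)).[z]| < b & True].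
  have /near0_pos[x [x0 h _]] : \forall h \near (0 : R), (h != 0 -> real_rooted (P h)) /\
    `|sqr_modulus (map_poly (real_complex R) (P 0)).[z] - sqr_modulus (map_poly (real_complex R) (P h)).[z]| < b.
    near=> h; split; near: h; first exact: HH.
    by move/cvgrPdist_lt : (analytic0_continuous cz); apply.
  by exists x; split.
rewrite gt_eqF // => /(_ isT)[rs Prs].
have srs : size rs = n by apply/eqP; rewrite -eqSS -(size_prod_XsubC rs id) -Prs sP.
rewrite (rootP rz) Prs => + _; apply/negP; rewrite -leNgt.
have -> : sqr_modulus 0 = 0 by rewrite /sqr_modulus /= expr0n addr0.
rewrite sub0r normrN; apply: le_trans (ler_norm _).
by rewrite /b -srs; apply: sqr_modulus_prod_ge.
Unshelve. all: by end_near.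
Qed.

Lemma real_rooted_dvd (p q : {poly R}) : p \is monic -> q \is monic ->
  real_rooted (p * q) -> real_rooted p.
Proof.
move=> pm qm [rs Hrs]; apply: real_rootedP => // z rz.
have : root (map_poly (real_complex R) (p * q)) z by rewrite rmorphM rootM rz.
rewrite Hrs rmorph_prod /= rootE horner_prod prodf_seq_eq0 => /hasP[r _] /=.
rewrite rmorphB /= map_polyX map_polyC /= -rootE root_XsubC => /eqP ->.
by [].
Qed.

(** For an eigenvector x + iy with eigenvalue a + ib, comparing [x *m A *m y^T] with its transpose
    gives b(|x|^2 + |y|^2) = 0. *)
Lemma sym_real_rooted n (A : 'M[R]_n) : A^T = A -> real_rooted (char_poly A).
Proof.
move=> AT; apply: real_rootedP; first exact: char_poly_monic.
move=> z; rewrite map_char_poly -eigenvalue_root_char => /eigenvalueP[v vA v0].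
pose x := map_mx (@complex.Re R) v; pose y := map_mx (@complex.Im R) v.
case: z vA => a b vA /=.
have hx : x *m A = a *: x - b *: y.
  apply/rowP => j; rewrite !mxE.
  have := congr1 (fun u : 'rV__ => complex.Re (u 0 j)) vA; rewrite !mxE.
  rewrite (big_morph _ ReD (erefl : complex.Re 0 = 0)).
  case: (v 0 j) => c d /= <-; apply: eq_bigr => i _; rewrite !mxE.
  by case: (v 0 i) => e f /=; rewrite mulr0 subr0.
have hy : y *m A = a *: y + b *: x.
  apply/rowP => j; rewrite !mxE.
  have := congr1 (fun u : 'rV__ => complex.Im (u 0 j)) vA; rewrite !mxE.
  rewrite (big_morph _ ImD (erefl : complex.Im 0 = 0)).
  case: (v 0 j) => c d /= <-; apply: eq_bigr => i _; rewrite !mxE.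
  by case: (v 0 i) => e f /=; rewrite mulr0 add0r.
have E : x *m A *m y^T = (y *m A *m x^T)^T by rewrite !trmx_mul trmxK AT mulmxA.
have {E} : b * ((x *m x^T) 0 0 + (y *m y^T) 0 0) = 0.
  move/(congr1 (fun M : 'M[R]_1 => M 0 0)): E; rewrite hx hy [RHS]mxE.
  rewrite mulmxBl mulmxDl -!scalemxAl.
  have -> : x *m y^T = y *m x^T.
    by apply/matrixP => i j; rewrite !ord1 -[y *m x^T]trmxK trmx_mul trmxK [RHS]mxE.
  by move: (y *m x^T) (x *m x^T) (y *m y^T) => X1 X2 X3; rewrite !mxE; lra.
move/eqP; rewrite mulf_eq0 => /orP[/eqP //|].
have sq (u : 'rV[R]_n) : (u *m u^T) 0 0 = \sum_j u 0 j ^+ 2.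
  by rewrite mxE; apply: eq_bigr => j _; rewrite mxE expr2.
have sq0 (u : 'rV[R]_n) : 0 <= (u *m u^T) 0 0 by rewrite sq sumr_ge0 // => j _; rewrite sqr_ge0.
rewrite paddr_eq0 // !sq !psumr_eq0; [|by move=> j _; rewrite sqr_ge0..].
move=> /andP[/allP hx0 /allP hy0]; case/negP: v0; apply/eqP/rowP => j; rewrite mxE.
have := hx0 j (mem_index_enum _); have := hy0 j (mem_index_enum _).
rewrite !mxE !sqrf_eq0 /=; case: (v 0 j) => c d /= /eqP -> /eqP ->; exact: erefl.
Qed.

End RealRooted.

(** * Local splitting of real-rooted families *)

Section LocalSplit.
Variable R : realType.
Implicit Types (P Q T : R -> {poly R}) (fs : seq (R -> R)).

(** The index is unbounded: past the end [nth] returns the zero function, which is analytic. *)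
Definition all_analytic0 fs := forall i, analytic0 (nth (fun _ : R => 0) fs i).

Definition splits_near0 P n := exists fs, [/\ all_analytic0 fs, size fs = n &
  \forall h \near (0 : R), P h = \prod_(f <- fs) ('X - (f h)%:P)].

Lemma all_analytic0_cat fs gs : all_analytic0 fs -> all_analytic0 gs -> all_analytic0 (fs ++ gs).
Proof. by move=> Hf Hg i; rewrite nth_cat; case: ifP. Qed.

Lemma all_analytic0_map fs (F : (R -> R) -> R -> R) : (forall f, analytic0 f -> analytic0 (F f)) -> all_analytic0 fs ->
  all_analytic0 (map F fs).
Proof.
move=> HF Hf i; have [ifs|ifs] := ltnP i (size fs).
  by rewrite (nth_map (fun _ : R => 0)) //; apply: HF.
by rewrite nth_default ?size_map //; apply: analytic0_cst.
Qed.

(** The device by which identities obtained after division by powers of [h] are carried to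
    [h = 0]. *)
Lemma analytic0_eq0 (f g : R -> R) : analytic0 f -> analytic0 g ->
  (\forall h \near (0 : R), h != 0 -> f h = g h) -> f 0 = g 0.
Proof.
move=> Hf Hg fg; apply/eqP; rewrite -subr_eq0; apply/negPn/negP => n0.
have Hfg := analytic0B Hf Hg; have := analytic0_near_neq0 Hfg n0 => h1.
have : \forall h \near (0 : R), f h - g h != 0 /\ (h != 0 -> f h = g h).
  by near=> h; split; near: h.
move=> /near0_pos[x [x0 [h2 h3] _]]; case/negP: h2; rewrite h3 ?subrr // gt_eqF //.
Unshelve. all: by end_near.
Qed.

Lemma coefXsubCM (a : R) p k : (('X - a%:P) * p)`_k = (if k is k'.+1 then p`_k' else 0) - a * p`_k.
Proof. by rewrite mulrBl coefB coefXM coefCM; case: k. Qed.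

Lemma prod_XsubC_comp (I : Type) (rs : seq I) (F : I -> R) c :
  (\prod_(r <- rs) ('X - (F r)%:P)) \Po ('X - c%:P) = \prod_(r <- rs) ('X - (F r + c)%:P).
Proof.
rewrite rmorph_prod /=; apply: eq_bigr => r _.
by rewrite comp_polyB comp_polyX comp_polyC polyCD opprD addrA addrAC.
Qed.

(** The coefficient of degree k is homogeneous of degree n - k in the roots; when the subtraction
    truncates, the coefficient is 0. *)
Lemma prod_XsubC_scale (I : Type) (rs : seq I) (F : I -> R) t k :
  (\prod_(r <- rs) ('X - (t * F r)%:P))`_k =
  t ^+ (size rs - k) * (\prod_(r <- rs) ('X - (F r)%:P))`_k.
Proof.
elim: rs k => [|r rs IH] k.
  by rewrite !big_nil sub0n expr0 mul1r.
rewrite !big_cons !coefXsubCM; case: k => [|k].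
  by rewrite !sub0r IH !subn0 /= exprS; ring.
rewrite !IH /= subSS mulrBr; congr (_ - _).
have [km|km] := ltnP k (size rs); last first.
  by rewrite [_`_k.+1]nth_default ?mulr0 // size_prod_XsubC.
by rewrite -(subnSK km) exprS; ring.
Qed.

Lemma prod_XsubC_coef_le (rs : seq R) (C : R) k : 0 <= C ->
  (forall r, r \in rs -> `|r| <= C) ->
  `|(\prod_(r <- rs) ('X - r%:P))`_k| <= (1 + C) ^+ size rs.
Proof.
move=> C0; elim: rs k => [|r rs IH] k Hr.
  by rewrite big_nil coef1; case: eqP; rewrite ?normr1 ?normr0 ?expr0.
have {}IH j : `|(\prod_(r <- rs) ('X - r%:P))`_j| <= (1 + C) ^+ size rs.
  by apply: IH => s sin; apply: Hr; rewrite inE sin orbT.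
rewrite big_cons coefXsubCM /= exprS mulrDl mul1r.
apply: le_trans (ler_normB _ _) _; apply: lerD.
  by case: k => [|k] //; rewrite normr0 exprn_ge0 // addr_ge0.
by rewrite normrM ler_pM // Hr // mem_head.
Qed.

(** Newton's identity p_2 = e_1^2 - 2 e_2. The list has two entries more than [rs], so e_2 is the
    coefficient of degree [size rs]. *)
Lemma prod_XsubC_sumsq (r s : R) (rs : seq R) :
  \sum_(x <- [:: r, s & rs]) x ^+ 2 =
  (\sum_(x <- [:: r, s & rs]) x) ^+ 2 - 2 * (\prod_(x <- [:: r, s & rs]) ('X - x%:P))`_(size rs).
Proof.
elim: rs r s => [|t rs IH] r s.
  by rewrite !big_cons !big_nil !mulr1 coefXsubCM coefB coefX coefC /=; ring.
rewrite big_cons [in LHS]big_cons IH [X in _ = X ^+ 2 - _]big_cons coefXsubCM /=.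
have -> : (\prod_(x <- [:: s, t & rs]) ('X - x%:P))`_(size rs).+1 = - \sum_(x <- [:: s, t & rs]) x.
  by rewrite -coefPn_prod_XsubC.
ring.
Qed.

Lemma real_rooted_size (p : {poly R}) n : size p = n.+1 -> real_rooted p ->
  exists2 rs : seq R, size rs = n & p = \prod_(r <- rs) ('X - r%:P).
Proof.
move=> sp [rs Hrs]; exists rs => //.
by apply/eqP; rewrite -eqSS -(size_prod_XsubC rs id) -Hrs sp.
Qed.

(** [p1] gathers all copies of the root [x] of [T 0] and [p2] the remaining roots, so they are
    coprime; the second root [y] makes both degrees smaller than [n]. *)
Lemma split_distinct n T :
  (forall m, (m < n)%N -> forall P, analytic0p P -> (forall h, P h \is monic) ->
     (forall h, size (P h) = m.+1) -> (\forall h \near (0 : R), real_rooted (P h)) ->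
     splits_near0 P m) ->
  analytic0p T -> (forall h, T h \is monic) -> (forall h, size (T h) = n.+1) ->
  (\forall h \near (0 : R), real_rooted (T h)) ->
  (exists x y, [/\ x != y, root (T 0) x & root (T 0) y]) ->
  splits_near0 T n.
Proof.
move=> IH HT mT sT rT [x [y [xy rx ry]]].
have [ts sts T0] := real_rooted_size (sT 0) (nbhs_singleton rT).
pose p1 := \prod_(t <- ts | t == x) ('X - t%:P).
pose p2 := \prod_(t <- ts | t != x) ('X - t%:P).
have p12 : T 0 = p1 * p2 by rewrite T0 (bigID (fun t => t == x)).
have m1 : p1 \is monic by apply: monic_prod_XsubC.
have m2 : p2 \is monic by apply: monic_prod_XsubC.
have xin : x \in ts by rewrite -root_prod_XsubC -T0.
have yin : y \in ts by rewrite -root_prod_XsubC -T0.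
pose n1 := count (fun t => t == x) ts; pose n2 := count (fun t => t != x) ts.
have s1 : size p1 = n1.+1 by rewrite /p1 -big_filter size_prod_XsubC size_filter.
have s2 : size p2 = n2.+1 by rewrite /p2 -big_filter size_prod_XsubC size_filter.
have n12 : (n1 + n2)%N = n by rewrite /n1 /n2 count_predC.
have n1p : (0 < n1)%N by rewrite -has_count; apply/hasP; exists x.
have n2p : (0 < n2)%N by rewrite -has_count; apply/hasP; exists y => //; rewrite eq_sym.
have cop : coprimep p1 p2.
  rewrite coprimep_sym /p1 (eq_bigr (fun _ => 'X - x%:P)) => [|t /eqP -> //].
  rewrite big_const_seq iter_mulr_1 coprimep_expr // coprimep_XsubC.
  rewrite /p2 -big_filter root_prod_XsubC mem_filter eqxx //.
have [T1 [T2 [HT1 HT2 mT1 mT2 TE]]] := hensel m1 m2 cop HT mT sT p12.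
have [|||||fs1 [an1 sz1 E1]] := IH n1 _ T1 => //.
- by rewrite -n12 -[X in (X < _)%N]addn0 ltn_add2l.
- by move=> h; have [] := mT1 h.
- by move=> h; have [_ ->] := mT1 h.
- near=> h; have [a _] := mT1 h; have [b _] := mT2 h; apply: (real_rooted_dvd a b).
  have <- : T h = T1 h * T2 h by near: h.
  by near: h.
have [|||||fs2 [an2 sz2 E2]] := IH n2 _ T2 => //.
- by rewrite -n12 -[X in (X < _)%N]add0n ltn_add2r.
- by move=> h; have [] := mT2 h.
- by move=> h; have [_ ->] := mT2 h.
- near=> h; have [a _] := mT2 h; have [b _] := mT1 h; apply: (real_rooted_dvd a b).
  rewrite mulrC; have <- : T h = T1 h * T2 h by near: h.
  by near: h.
exists (fs1 ++ fs2); split; [exact: all_analytic0_cat|by rewrite size_cat sz1 sz2|].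
near=> h; rewrite big_cat /=.
have <- : T1 h = \prod_(i <- fs1) ('X - (i h)%:P) by near: h.
have <- : T2 h = \prod_(i <- fs2) ('X - (i h)%:P) by near: h.
by near: h.
Unshelve. all: by end_near.
Qed.

(* Depressed case: with zero sum of roots, the sum of squares is an analytic
   function h^(2m) u(h), hence every root is O(h^m) and h^m factors out. *)
Lemma split_depressed n Q : (1 < n)%N ->
  (forall m, (m < n)%N -> forall P, analytic0p P -> (forall h, P h \is monic) ->
     (forall h, size (P h) = m.+1) -> (\forall h \near (0 : R), real_rooted (P h)) ->
     splits_near0 P m) ->
  analytic0p Q -> (forall h, Q h \is monic) -> (forall h, size (Q h) = n.+1) ->
  (\forall h \near (0 : R), real_rooted (Q h)) ->
  (\forall h \near (0 : R), (Q h)`_n.-1 = 0) -> splits_near0 Q n.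
Proof.
move=> n1 IH HQ mQ sQ rQ Q1.
(* By Newton's identity this is the sum of squares of the roots as soon as their sum is 0. *)
pose s h := - (2 * (Q h)`_n.-2).
have Hs : analytic0 s by apply/analytic0N/analytic0M; [apply: analytic0_cst|apply: HQ].
have sumsq (p : {poly R}) (rs : seq R) : size rs = n -> p = \prod_(r <- rs) ('X - r%:P) ->
    p`_n.-1 = - \sum_(r <- rs) r /\
    \sum_(r <- rs) r ^+ 2 = (\sum_(r <- rs) r) ^+ 2 - 2 * p`_n.-2.
  move=> srs ->; split; first by rewrite -srs coefPn_prod_XsubC // srs; case: (n) n1.
  move: srs n1; case: rs => [|r [|t rs]] <- // _; exact: prod_XsubC_sumsq.
have Hrs : \forall h \near (0 : R), exists rs : seq R, [/\ size rs = n,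
    Q h = \prod_(r <- rs) ('X - r%:P) & \sum_(r <- rs) r ^+ 2 = s h].
  near=> h; have rQh : real_rooted (Q h) by near: h.
  have [rs srs E] := real_rooted_size (sQ h) rQh.
  exists rs; split=> //; have [e1 ->] := sumsq _ _ srs E.
  have : (Q h)`_n.-1 = 0 by near: h.
  by rewrite e1 => /eqP; rewrite oppr_eq0 => /eqP ->; rewrite expr0n /= sub0r.
have sq_le (rs : seq R) r : r \in rs -> r ^+ 2 <= \sum_(r <- rs) r ^+ 2.
  move=> rin; rewrite (big_rem r) //= lerDl.
  by apply: sumr_ge0 => x _; rewrite sqr_ge0.
case: (analytic0_order Hs) => [s0|[p [u [Hu u0 su]]]].
  exists (nseq n (fun _ => 0)); split; first by move=> i; rewrite nth_nseq; case: ifP => _; apply: analytic0_cst.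
    by rewrite size_nseq.
  near=> h; rewrite big_nseq iter_mulr_1.
  have [rs [srs -> E]] : exists rs : seq R, [/\ size rs = n,
    Q h = \prod_(r <- rs) ('X - r%:P) & \sum_(r <- rs) r ^+ 2 = s h] by near: h.
  have sh0 : s h = 0 by near: h.
  rewrite -srs -(count_predT rs) -iter_mulr_1 -big_const_seq !big_seq.
  apply: eq_bigr => r /sq_le; rewrite E sh0 => h0.
  by congr ('X - _%:P); apply/eqP; rewrite -sqrf_eq0 eq_le h0 sqr_ge0.
have s_ge0 : \forall h \near (0 : R), 0 <= s h.
  by apply: filterS Hrs => h [rs [_ _ <-]]; apply: sumr_ge0 => r _; rewrite sqr_ge0.
have ueps : \forall h \near (0 : R), `|u 0 - u h| < `|u 0|.
  by move/cvgrPdist_lt : (analytic0_continuous Hu); apply; rewrite normr_gt0.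
have evp := analytic0_nonneg_even_order Hu u0 su s_ge0.
pose m := p./2.
have pE : p = (m * 2)%N by rewrite muln2 -[LHS]odd_double_half (negPf evp).
(* Near 0, [u h < 2 * |u 0| <= C ^+ 2], so [C] bounds every rescaled root. *)
pose C := 1 + (2 * `|u 0|); have C0 : 0 <= C by rewrite addr_ge0 // mulr_ge0.
have rle : \forall h \near (0 : R), h != 0 -> exists rs : seq R, [/\ size rs = n,
    Q h = \prod_(r <- rs) ('X - (h ^+ m * r)%:P), \sum_(r <- rs) r ^+ 2 = u h &
    forall r, r \in rs -> `|r| <= C].
  near=> h => h0.
  have [rs [srs E E2]] : exists rs : seq R, [/\ size rs = n,
    Q h = \prod_(r <- rs) ('X - r%:P) & \sum_(r <- rs) r ^+ 2 = s h] by near: h.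
  have uh : `|u 0 - u h| < `|u 0| by near: h.
  have hm0 : h ^+ m != 0 by rewrite expf_neq0.
  exists (map (fun r => r / h ^+ m) rs).
  have S2 : \sum_(r <- [seq r / h ^+ m | r <- rs]) r ^+ 2 = u h.
    rewrite big_map; under eq_bigr do rewrite exprMn.
    by rewrite -mulr_suml E2 su pE exprM exprVn mulrAC divff ?mul1r // expf_neq0.
  split=> //; first by rewrite size_map.
    by rewrite E big_map; apply: eq_bigr => r _; rewrite mulrC divfK.
  move=> r rin; have := sq_le _ _ rin; rewrite S2 => rle.
  have uC : u h <= C ^+ 2.
    have : 0 <= `|u 0| by [].
    have := ler_norm (u 0); move: uh; rewrite ltr_norml /C; set U := `|u 0|; nra.
  by rewrite -(@ler_pXn2r _ 2) ?nnegrE // real_normK ?num_real //; apply: le_trans uC.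
(* Homogeneity and the bound on the rescaled roots make the coefficient of degree [k] of order
   [h ^+ (m * (n - k))], so [analytic0_divX] applies; the quotients are the coefficients of the
   rescaled family [T]. *)
have /choice[g Hg] : forall k : nat, exists g : R -> R, analytic0 g /\ ((k <= n)%N ->
    \forall h \near (0 : R), (Q h)`_k = (h ^+ m) ^+ (n - k) * g h).
  move=> k; have [kn|kn] := leqP k n; last by exists (fun _ => 0); split; first exact: analytic0_cst.
  have [|g Hg Eg] := analytic0_divX (m := (m * (n - k))%N) (C := (1 + C) ^+ n) (HQ k).
    apply: filterS rle => h rle /rle[rs [srs -> _ rC]].
    rewrite prod_XsubC_scale srs exprM normrM mulrC !normrX; apply: ler_wpM2r.
      by rewrite !exprn_ge0.
    by rewrite -srs; apply: prod_XsubC_coef_le.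
  by exists g; split=> // _; apply: filterS Eg => h ->; rewrite exprM.
pose T h := 'X^n + \sum_(k < n) (g k h)%:P * 'X^k.
have Tk h k : (T h)`_k = if (k < n)%N then g k h else (k == n)%:R.
  rewrite /T coefD coef_sum coefXn; case: ltnP => kn.
    rewrite ltn_eqF // add0r (bigD1 (Ordinal kn)) //= coefCM coefXn eqxx mulr1 big1 ?addr0 //.
    move=> j jk; rewrite coefCM coefXn; case: eqP => [kj|]; last by rewrite mulr0.
    by case/negP: jk; apply/eqP/val_inj.
  rewrite big1 ?addr0 // => j _; rewrite coefCM coefXn gtn_eqF ?mulr0 //.
  exact: leq_trans (ltn_ord j) kn.
have HT : analytic0p T.
  move=> k; apply: (analytic0_eq (f := fun h => if (k < n)%N then g k h else (k == n)%:R)) => [h|].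
    by rewrite Tk.
  by case: ltnP => _; [have [] := Hg k|apply: analytic0_cst].
have sum_small h : (size (\sum_(k < n) (g k h)%:P * 'X^k)%R < n.+1)%N.
  apply: size_sum_lt => // k; rewrite mul_polyC; apply: leq_ltn_trans (size_scale_leq _ _) _.
  by rewrite size_polyXn ltnS ltn_ord.
have sT h : size (T h) = n.+1 by rewrite size_polyDl size_polyXn.
have mT h : T h \is monic by rewrite monicE lead_coefDl ?size_polyXn // lead_coefXn.
have QT : \forall h \near (0 : R), forall k : 'I_n.+1, (Q h)`_k = (h ^+ m) ^+ (n - k) * (T h)`_k.
  suff H (k : 'I_n.+1) : \forall h \near (0 : R), (Q h)`_k = (h ^+ m) ^+ (n - k) * (T h)`_k.
    exact: (filter_forall _ H).
  have [kn|kn] := ltnP k n.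
    have [_ /(_ (ltnW kn))] := Hg k; apply: filterS => h ->; by rewrite Tk kn.
  have -> : (k : nat) = n by have := ltn_ord k; lia.
  apply: filterS filterT => h _; rewrite subnn expr0 mul1r Tk ltnn eqxx.
  by have := mQ h; rewrite monicE /lead_coef sQ => /eqP.
have rT' : \forall h \near (0 : R), h != 0 -> exists rs : seq R, [/\ size rs = n,
    T h = \prod_(r <- rs) ('X - r%:P) & \sum_(r <- rs) r ^+ 2 = u h].
  near=> h => h0.
  have [rs [srs QE S2 _]] : exists rs : seq R, [/\ size rs = n,
    Q h = \prod_(r <- rs) ('X - (h ^+ m * r)%:P), \sum_(r <- rs) r ^+ 2 = u h &
    forall r, r \in rs -> `|r| <= C] by move: h0; near: h.
  exists rs; split=> //; apply/polyP => k.
  have [kn|kn] := leqP k n; last by rewrite !nth_default // ?sT // size_prod_XsubC srs.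
  have QTh : forall k : 'I_n.+1, (Q h)`_k = (h ^+ m) ^+ (n - k) * (T h)`_k by near: h.
  have := QTh (Ordinal (kn : (k < n.+1)%N)); rewrite /= QE prod_XsubC_scale srs.
  by move/mulfI => -> //; rewrite !expf_neq0.
have rT0 : real_rooted (T 0).
  apply: (real_rooted_limit HT mT sT); apply: filterS rT' => h H /H[rs [_ -> _]].
  by exists rs.
have rT : \forall h \near (0 : R), real_rooted (T h).
  apply: filterS rT' => h H; have [->//|/H[rs [_ -> _]]] := eqVneq h 0.
  by exists rs.
have T01 : (T 0)`_n.-1 = 0.
  apply: (analytic0_eq0 (HT _) (analytic0_cst 0)); near=> h => h0.
  have : forall k : 'I_n.+1, (Q h)`_k = (h ^+ m) ^+ (n - k) * (T h)`_k by near: h.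
  have nn : (n.-1 < n.+1)%N by lia.
  move=> /(_ (Ordinal nn)) /=.
  have -> : (Q h)`_n.-1 = 0 by near: h.
  by move/esym/eqP; rewrite mulf_eq0 !expf_eq0 (negPf h0) !andbF /= => /eqP.
have T02 : - (2 * (T 0)`_n.-2) = u 0.
  apply: (@analytic0_eq0 (fun h => - (2 * (T h)`_n.-2))) => //.
    by apply/analytic0N/analytic0M; [apply: analytic0_cst|apply: HT].
  near=> h => h0.
  have : forall k : 'I_n.+1, (Q h)`_k = (h ^+ m) ^+ (n - k) * (T h)`_k by near: h.
  have nn : (n.-2 < n.+1)%N by lia.
  move=> /(_ (Ordinal nn)) /=; have -> : (n - n.-2)%N = 2 by lia.
  rewrite -exprM -pE => QTh.
  have hp : h ^+ p != 0 by rewrite expf_neq0.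
  apply: (mulfI hp); rewrite -su /s QTh; ring.
(* The roots of [T 0] have sum 0 and sum of squares [u 0 != 0], so they are not all equal. *)
have [fs [afs sfs TE]] : splits_near0 T n.
  apply: split_distinct => //.
  have [ts sts T0] := real_rooted_size (sT 0) rT0.
  have [e1 e2] := sumsq _ _ sts T0.
  have S1 : \sum_(r <- ts) r = 0 by apply/eqP; rewrite -oppr_eq0 -e1 T01.
  have S2 : \sum_(r <- ts) r ^+ 2 != 0 by rewrite e2 S1 expr0n /= sub0r T02.
  have [x xin xn0] : exists2 x, x \in ts & x != 0.
    apply/hasP; apply: contraNT S2 => /hasPn h; rewrite big_seq big1 // => r /h.
    by rewrite negbK => /eqP ->; rewrite expr0n.
  have [y yin yx] : exists2 y, y \in ts & y != x.
    apply/hasP; apply: contraTT isT => /hasPn h; exfalso.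
    move: S1; rewrite big_seq (eq_bigr (fun _ => x)) => [|r /h]; last by rewrite negbK => /eqP.
    rewrite -big_seq big_const_seq count_predT iter_addr_0 sts => /eqP.
    by rewrite mulrn_eq0 (negPf xn0) orbF; move: n1; case: (n).
  by exists x, y; rewrite eq_sym T0 !root_prod_XsubC.
exists (map (fun f h => h ^+ m * f h) fs); split; last 2 first.
- by rewrite size_map.
- near=> h; rewrite big_map; apply/polyP => k; rewrite prod_XsubC_scale.
  have [kn|kn] := leqP k n; last by rewrite !nth_default ?mulr0 ?sQ // size_prod_XsubC sfs.
  have QTh : forall k : 'I_n.+1, (Q h)`_k = (h ^+ m) ^+ (n - k) * (T h)`_k by near: h.
  have TEh : T h = \prod_(f <- fs) ('X - (f h)%:P) by near: h.
  by rewrite (QTh (Ordinal (kn : (k < n.+1)%N))) sfs /= TEh.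
- apply: all_analytic0_map afs => f Hf; apply: analytic0M Hf; exact: (analytic0X m (@analytic0_id R)).
Unshelve. all: by end_near.
Qed.

Theorem real_rooted_split n P : analytic0p P -> (forall h, P h \is monic) ->
  (forall h, size (P h) = n.+1) -> (\forall h \near (0 : R), real_rooted (P h)) ->
  splits_near0 P n.
Proof.
elim/ltn_ind: n P => n IH P HP mP sP rP.
have [n1|] := ltnP 1 n; last first.
  case: n sP {IH} => [|[|//]] sP _.
    exists [::]; split=> //; first by move=> i; rewrite nth_nil; apply: analytic0_cst.
    apply: filterS filterT => h _; rewrite big_nil.
    have := mP h; rewrite monicE /lead_coef sP /= => /eqP P0.
    by apply/polyP => -[|k]; rewrite coef1 // nth_default ?sP.
  exists [:: fun h => - (P h)`_0]; split=> //.
    move=> [|i] /=; [exact/analytic0N/HP|rewrite nth_nil; exact: analytic0_cst].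
  apply: filterS filterT => h _; rewrite big_seq1.
  have := mP h; rewrite monicE /lead_coef sP /= => /eqP P1.
  apply/polyP => -[|[|k]]; rewrite coefB coefX coefC /=.
  - by rewrite sub0r opprK.
  - by rewrite P1 subr0.
  - by rewrite nth_default ?sP // subr0.
(* The mean of the roots; composing with the shift by [c h] centres them. *)
pose c h := - (P h)`_n.-1 / n%:R.
have Hc : analytic0 c by apply: analytic0M (analytic0_cst _); apply/analytic0N/HP.
pose Q h := P h \Po ('X - (- c h)%:P).
have n0 : n%:R != 0 :> R by rewrite pnatr_eq0; lia.
have HQ : analytic0p Q.
  apply: (analytic0p_eq (P := fun h => \sum_(i < n.+1) ((P h)`_i)%:P * ('X - (- c h)%:P) ^+ i)).
    by move=> h; rewrite /Q comp_polyE sP; apply: eq_bigr => i _; rewrite mul_polyC.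
  apply: analytic0p_sum => i; apply: analytic0pM; first exact/analytic0pC/HP.
  apply: analytic0p_exp; apply: analytic0p_eq (analytic0pD (analytic0p_cst 'X) (analytic0pC (f := c) Hc)) => h.
  by rewrite polyCN opprK.
have sQ h : size (Q h) = n.+1 by rewrite size_comp_poly2 ?sP // size_XsubC.
have mQ h : Q h \is monic.
  by rewrite monicE lead_coef_comp ?size_XsubC // lead_coefXsubC expr1n mulr1 -monicE.
have QE h (rs : seq R) : P h = \prod_(r <- rs) ('X - r%:P) -> Q h = \prod_(r <- rs) ('X - (r - c h)%:P).
  by move=> Ph; rewrite /Q Ph prod_XsubC_comp.
have [||fs [afs sfs FE]] := split_depressed n1 IH HQ mQ sQ.
- apply: filterS rP => h [rs /QE ->]; exists (map (fun r => r - c h) rs).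
  by rewrite big_map.
- apply: filterS rP => h /(real_rooted_size (sP h))[rs srs Ph]; rewrite (QE _ _ Ph).
  have := coefPn_prod_XsubC (ps := rs); rewrite -Ph srs => /(_ _)/[dup] P1.
  rewrite -(big_map (fun r => r - c h) xpredT (fun r => 'X - r%:P)).
  have := coefPn_prod_XsubC (ps := map (fun r => r - c h) rs); rewrite size_map srs => -> //; last by lia.
  have cn : c h *+ n = \sum_(r <- rs) r.
    by rewrite -[LHS]mulr_natr /c P1 ?opprK ?divfK //; lia.
  by rewrite big_map sumrB big_const_seq count_predT iter_addr_0 srs cn subrr oppr0.
exists (map (fun f h => f h + c h) fs); split; last 2 first.
- by rewrite size_map.
- apply: filterS FE => h; rewrite big_map => FE.
  have -> : P h = Q h \Po ('X - (c h)%:P).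
    rewrite /Q -comp_polyA comp_polyB comp_polyX comp_polyC polyCN opprK subrK comp_polyXr //.
  by rewrite FE prod_XsubC_comp.
- by apply: all_analytic0_map afs => f Hf; apply: analytic0D.
Qed.

End LocalSplit.

(** * Global analytic branches *)

Section Glue.
Variable R : realType.

Definition analytic_at (f : R -> R) x := analytic0 (fun y => f (x + y)).

Lemma near_translate (x : R) (Q : R -> Prop) :
  (\forall y \near x, Q y) <-> (\forall d \near (0 : R), Q (x + d)).
Proof.
split=> /nbhs_ballP[e /= e0 He]; apply/nbhs_ballP; exists e => // y; rewrite /ball /=.
  by rewrite sub0r normrN => hy; apply: He; rewrite /ball /= opprD addrA subrr sub0r normrN.
move=> hy; rewrite -[y](subrK x) addrC; apply: He.
by rewrite /ball /= sub0r normrN distrC.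
Qed.

Lemma analytic_at_near f x : analytic_at f x -> \forall y \near x, analytic_at f y.
Proof.
move=> /analytic0_recenter Hf; apply/near_translate; apply: filterS Hf => d.
by apply: analytic0_eq => y; rewrite addrA.
Qed.

Lemma analytic_at_ext f g x : (\forall y \near x, f y = g y) -> analytic_at f x -> analytic_at g x.
Proof. by move=> /near_translate fg; apply: analytic0_ext. Qed.

(** The interior [E] of the coincidence set is relatively closed in [U]: at a limit point the
    difference cannot have an isolated zero, so it vanishes nearby. Connectedness of [U]
    concludes. *)
Lemma identity_theorem (U : set R) f g c : is_interval U ->
  (forall x, U x -> analytic_at f x /\ analytic_at g x) ->
  U c -> (\forall y \near c, f y = g y) ->
  forall t, U t -> \forall y \near t, f y = g y.
Proof.
move=> /connected_intervalP cU fgU Uc fgc.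
pose E := [set y | f y = g y]°.
suff BU : U `&` E = U by move=> t; rewrite -[U in U t]BU => -[].
apply: cU; first by exists c.
  by exists E => //; apply: open_interior.
exists (closure E); first exact: closed_closure.
apply/seteqP; split=> t [Ut Et]; split=> //; first exact: subset_closure.
have [Hf Hg] := fgU t Ut.
case: (analytic0_zero_or_isolated (analytic0B Hf Hg)) => [H|H].
  by apply/near_translate; apply: filterS H => d /eqP; rewrite subr_eq0 => /eqP.
have H' : \forall y \near t, y - t != 0 -> f y - g y != 0.
  apply/near_translate; apply: filterS H => d; by rewrite addrAC subrr add0r.
have [y [Ey yt]] := Et _ H'.
have [<-//|ny] := eqVneq y t.
by move: yt; rewrite /= subr_eq0 => /(_ ny); rewrite (nbhs_singleton Ey) subrr eqxx.
Qed.

(** There is one small [h > 0] at which any two germs [F i], [G j] that are not identical take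
    different values. A permutation matching the values at [x + h] therefore matches the germs. *)
Lemma germ_matching n (F G : 'I_n -> R -> R) x :
  (forall k, analytic_at (F k) x) -> (forall k, analytic_at (G k) x) ->
  (\forall y \near x, \prod_k ('X - (F k y)%:P) = \prod_k ('X - (G k y)%:P)) ->
  exists s : 'S_n, \forall y \near x, forall k, F k y = G (s k) y.
Proof.
move=> HF HG /near_translate FG.
have [h [h0 [hiso hprod] _]] : exists h, [/\ 0 < h,
   (forall ij : 'I_n * 'I_n, (\forall y \near (0 : R), F ij.1 (x + y) - G ij.2 (x + y) = 0) \/
      (h != 0 -> F ij.1 (x + h) - G ij.2 (x + h) != 0)) /\
   \prod_k ('X - (F k (x + h))%:P) = \prod_k ('X - (G k (x + h))%:P) & True].
  have H (ij : 'I_n * 'I_n) : \forall h \near (0 : R),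
      (\forall y \near (0 : R), F ij.1 (x + y) - G ij.2 (x + y) = 0) \/
      (h != 0 -> F ij.1 (x + h) - G ij.2 (x + h) != 0).
    case: (analytic0_zero_or_isolated (analytic0B (HF ij.1) (HG ij.2))) => K.
      by apply: filterS filterT => h _; left.
    by apply: filterS K => h Kh; right.
  have := filter_forall _ H; have FF := nbhs_filter (0 : R).
  move=> H'; have [h [h0 h1 _]] := near0_pos (filterI (H' _) FG).
  by exists h; split.
have pe : perm_eq [tuple F k (x + h) | k < n] [tuple G k (x + h) | k < n].
  apply: prod_XsubC_eq; rewrite !big_tuple.
  by under eq_bigr do rewrite tnth_mktuple; under [RHS]eq_bigr do rewrite tnth_mktuple.
have /tuple_permP[s Hs] := pe; exists s.
suff H k : \forall y \near x, F k y = G (s k) y by exact: (filter_forall _ H).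
have E : F k (x + h) = G (s k) (x + h).
  have := congr1 (fun t : seq R => nth 0 t k) Hs.
  by rewrite -!tnth_nth !tnth_mktuple.
apply/near_translate; case: (hiso (k, s k)) => /=.
  by apply: filterS => y /eqP; rewrite subr_eq0 => /eqP.
by rewrite gt_eqF // E subrr eqxx => /(_ isT).
Qed.

Variables (n : nat) (P : R -> {poly R}).

Definition branch_system (F : 'I_n -> R -> R) (U : set R) := forall x, U x ->
  (forall k, analytic_at (F k) x) /\ P x = \prod_k ('X - (F k x)%:P).

(** The permutation found at [c] is valid on the whole overlap by the identity theorem, because the
    overlap is an interval; [G] is renumbered by it. *)
Lemma branch_system_patch (U V : set R) F G c : open U -> open V -> is_interval (U `&` V) ->
  branch_system F U -> branch_system G V -> (U `&` V) c ->
  exists H, branch_system H (U `|` V) /\ forall x, U x -> forall k, H k x = F k x.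
Proof.
move=> oU oV iUV sF sG [Uc Vc].
have nU x : U x -> \forall y \near x, U y by move=> Ux; apply: open_nbhs_nbhs.
have nV x : V x -> \forall y \near x, V y by move=> Vx; apply: open_nbhs_nbhs.
have [|||s Hs] := @germ_matching n F G c.
- by move=> k; have [/(_ k)] := sF _ Uc.
- by move=> k; have [/(_ k)] := sG _ Vc.
- near=> y; have /sF[_ <-] : U y by near: y; apply: nU.
  by have /sG[_ <-] : V y by near: y; apply: nV.
have FG x : U x -> V x -> forall k, F k x = G (s k) x.
  move=> Ux Vx k.
  have := @identity_theorem (U `&` V) (F k) (G (s k)) c iUV.
  move=> /(_ _ (conj Uc Vc) _ x (conj Ux Vx)) H; apply: (nbhs_singleton (H _ _)).
    by move=> y [/sF[a _] /sG[b _]].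
  by apply: filterS Hs => y; apply.
exists (fun k x => if x \in U then F k x else G (s k) x); split; last first.
  by move=> x Ux k; rewrite mem_set.
have HV k y : V y -> (if y \in U then F k y else G (s k) y) = G (s k) y.
  by move=> Vy; case: (boolP (y \in U)) => // /set_mem Uy; apply: FG.
move=> x UVx; case: (pselect (U x)) => [Ux|nUx].
  split=> [k|].
    apply: analytic_at_ext (proj1 (sF x Ux) k).
    by apply: filterS (nU _ Ux) => y Uy; rewrite mem_set.
  by rewrite (proj2 (sF x Ux)); apply: eq_bigr => k _; rewrite mem_set.
have Vx : V x by case: UVx.
split=> [k|].
  apply: analytic_at_ext (proj1 (sG x Vx) (s k)).
  by apply: filterS (nV _ Vx) => y Vy; rewrite HV.
rewrite (proj2 (sG x Vx)) (reindex_inj (@perm_inj _ s)) /=.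
by apply: eq_bigr => k _; rewrite HV.
Unshelve. all: by end_near.
Qed.

Lemma branch_system_sub F (U V : set R) : V `<=` U -> branch_system F U -> branch_system F V.
Proof. by move=> VU sF x /VU; apply: sF. Qed.

Lemma branch_system_unique F G (U : set R) c : is_interval U -> branch_system F U -> branch_system G U -> U c ->
  (forall k, \forall y \near c, F k y = G k y) -> forall x, U x -> forall k, F k x = G k x.
Proof.
move=> iU sF sG Uc FG x Ux k.
apply: (nbhs_singleton (identity_theorem iU _ Uc (FG k) Ux)).
by move=> y Uy; split; [have [/(_ k)] := sF y Uy|have [/(_ k)] := sG y Uy].
Qed.

Let oo (a b : R) : set R := [set x | a < x < b].

Lemma oo_open a b : open (oo a b).
Proof.
rewrite (_ : oo a b = [set` `]a, b[%R]); first exact: interval_open.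
by apply/seteqP; split=> x; rewrite /oo /= in_itv.
Qed.

Lemma oo_interval a b : is_interval (oo a b).
Proof.
move=> x y /andP[ax xb] /andP[ay yb] z /andP[xz zy].
by rewrite /oo /= (lt_le_trans ax xz) (le_lt_trans zy yb).
Qed.

Lemma is_intervalI (A B : set R) : is_interval A -> is_interval B -> is_interval (A `&` B).
Proof.
by move=> iA iB x y [Ax Bx] [Ay By] z xyz; split; [apply: iA xyz|apply: iB xyz].
Qed.

Lemma branch_system_extend a b c d e F : a < e < b -> c < e < d ->
  branch_system F (oo a b) -> (exists G, branch_system G (oo c d)) ->
  exists H, branch_system H (oo (Num.min a c) (Num.max b d)) /\
    forall x, a < x < b -> forall k, H k x = F k x.
Proof.
move=> aeb ced sF [G sG].
have [|||//|H [sH HF]] := @branch_system_patch (oo a b) (oo c d) F G e _ _ _ sF sG.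
- exact: oo_open.
- exact: oo_open.
- by apply: is_intervalI; apply: oo_interval.
exists H; split=> //; apply: branch_system_sub sH => x; rewrite /oo /= gt_min lt_max.
move: aeb ced => /andP[ae eb] /andP[ce ed] /andP[/orP[ax|cx] /orP[xb|xd]].
- by left; rewrite ax.
- by have [xb|bx] := ltP x b; [left; rewrite ax|right; rewrite xd andbT; apply: lt_le_trans bx; apply: lt_trans eb].
- by have [xd|dx] := ltP x d; [right; rewrite cx|left; rewrite xb andbT; apply: lt_le_trans dx; apply: lt_trans ed].
- by right; rewrite cx.
Qed.

Lemma branch_system_global : (forall x, exists G e, 0 < e /\ branch_system G (oo (x - e) (x + e))) ->
  exists F, branch_system F setT.
Proof.
move=> loc; have [G0 [e0 [e00 sG0]]] := loc 0.
(* Prescribing the germ [G0] at 0 fixes the numbering, so systems on different intervals agree where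
   both are defined. *)
pose Q x := exists H, branch_system H (oo (- x) x) /\ forall k, \forall y \near (0 : R), H k y = G0 k y.
have Qe0 : Q e0 by exists G0; split; [rewrite sub0r add0r in sG0|move=> k; apply: filterS filterT].
have Qle x y : x <= y -> Q y -> Q x.
  move=> xy [H [sH HG]]; exists H; split=> //; apply: branch_system_sub sH => z; rewrite /oo /=; lra.
have Qall x : Q x.
  apply: contrapT => nQ.
  have E0 : has_sup [set y | Q y].
    split; first by exists e0.
    exists x => y Qy; rewrite leNgt; apply/negP => xy; apply: nQ; apply: Qle Qy; exact: ltW.
  set s := sup [set y | Q y].
  have se : e0 <= s by apply: ub_le_sup => //; case: E0.
  have [G1 [e1 [e10 sG1]]] := loc s; have [G2 [e2 [e20 sG2]]] := loc (- s).
  pose e := Num.min s (Num.min e1 e2).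
  have e_gt0 : 0 < e by rewrite !lt_min e10 e20 (lt_le_trans e00).
  have [es ee1 ee2] : [/\ e <= s, e <= e1 & e <= e2].
    by rewrite !ge_min !lexx !orbT.
  have [x' Qx' sx'] := sup_adherent e_gt0 E0; rewrite -/s in sx'.
  have x's : x' <= s by apply: ub_le_sup => //; case: E0.
  have [H [sH HG]] := Qx'.
  (* The midpoint of [s - e] and [x'] lies in both intervals. Extending past [s], and then past
     [- s], contradicts the supremum. *)
  have [||||H1 [sH1 H1E]] := @branch_system_extend (- x') x' (s - e1) (s + e1) ((s - e + x') / 2) H.
  - by apply/andP; split; lra.
  - by apply/andP; split; lra.
  - exact: sH.
  - by exists G1.
  have m1 : Num.min (- x') (s - e1) <= - x' by rewrite ge_min lexx.
  have M1 : s + e1 <= Num.max x' (s + e1) by rewrite le_max lexx orbT.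
  have [||||H2 [sH2 H2E]] := @branch_system_extend (Num.min (- x') (s - e1)) (Num.max x' (s + e1))
    (- s - e2) (- s + e2) (- ((s - e + x') / 2)) H1.
  - by apply/andP; split; lra.
  - by apply/andP; split; lra.
  - exact: sH1.
  - by exists G2.
  have m2 : Num.min (Num.min (- x') (s - e1)) (- s - e2) <= - s - e2 by rewrite ge_min lexx orbT.
  have M2 : Num.max x' (s + e1) <= Num.max (Num.max x' (s + e1)) (- s + e2) by rewrite le_max lexx.
  have : Q (s + e).
    exists H2; split; first by apply: branch_system_sub sH2 => z; rewrite /oo /= => /andP[? ?]; apply/andP; split; lra.
    move=> k.
    have H0 : \forall y \near (0 : R), - x' < y < x'.
      apply: (@open_nbhs_nbhs _ (0 : R) (oo (- x') x')); split; first exact: oo_open.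
      by rewrite /oo /=; apply/andP; split; lra.
    have HG0 := HG k; near=> y.
    have yx : - x' < y < x' by near: y.
    rewrite H2E ?H1E //; first by near: y.
    by case/andP: yx => ? ?; apply/andP; split; lra.
  move=> Qse; have : s + e <= s by apply: ub_le_sup => //; case: E0.
  lra.
have [H HH] := choice Qall.
have Heq x y k : `|y| < x -> H (`|y| + 1) k y = H x k y.
  move=> yx; pose m := Num.min x (`|y| + 1).
  have [mx my] : m <= x /\ m <= `|y| + 1 by rewrite !ge_min !lexx orbT.
  have ym : `|y| < m by rewrite lt_min yx ltrDl ltr01.
  have [s1 g1] := HH x; have [s2 g2] := HH (`|y| + 1).
  apply: (@branch_system_unique _ _ (oo (- m) m) 0) => //.
  - exact: oo_interval.
  - by apply: branch_system_sub s2 => z; rewrite /oo /= => /andP[? ?]; apply/andP; split; lra.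
  - by apply: branch_system_sub s1 => z; rewrite /oo /= => /andP[? ?]; apply/andP; split; lra.
  - rewrite /oo /=; have := normr_ge0 y; lra.
  - by move=> j; apply: filterS2 (g1 j) (g2 j) => z -> ->.
  - by rewrite /oo /= -ltr_norml.
(* The radius varies with [y]; by [Heq] the value does not depend on it. *)
exists (fun k y => H (`|y| + 1) k y) => x _.
have [sx _] := HH (`|x| + 1).
have /sx[a Px] : oo (- (`|x| + 1)) (`|x| + 1) x by rewrite /oo /= -ltr_norml ltrDl ltr01.
split=> // k; apply: analytic_at_ext (a k).
have : \forall y \near x, `|x - y| < 1 by apply/nbhs_ballP; exists 1 => //=.
apply: filterS => y xy; apply/esym/Heq.
have := ler_distD x y 0; rewrite !subr0 distrC; lra.
Unshelve. all: by end_near.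
Qed.

Lemma branch_system_local x : (forall k, analytic0 (fun h => (P (x + h))`_k)) ->
  (forall h, P h \is monic) -> (forall h, size (P h) = n.+1) -> (forall h, real_rooted (P h)) ->
  exists G e, 0 < e /\ branch_system G (oo (x - e) (x + e)).
Proof.
move=> HP mP sP rP.
have [||||fs [afs sfs E]] := @real_rooted_split R n (fun h => P (x + h)) => //.
- exact: filterS filterT.
pose G (k : 'I_n) y := nth (fun _ => 0) fs k (y - x).
have aG k : analytic_at (G k) x.
  by apply: analytic0_eq (afs k) => y; rewrite /G addrC addrA addNr add0r.
have : \forall y \near x, (forall k, analytic_at (G k) y) /\ P y = \prod_k ('X - (G k y)%:P).
  have H1 : \forall y \near x, forall k, analytic_at (G k) y.
    exact: (filter_forall _ (fun k => analytic_at_near (aG k))).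
  have H2 : \forall y \near x, P y = \prod_k ('X - (G k y)%:P).
    apply/near_translate; apply: filterS E => h ->.
    rewrite (big_nth (fun _ => 0)) big_mkord sfs; apply: eq_bigr => k _.
    by rewrite /G addrAC subrr add0r.
  by apply: filterS2 H1 H2.
move=> /nbhs_ballP[e /= e0 He]; exists G, e; split=> // y; rewrite /oo /= => hy.
by apply: He; rewrite /ball /= ltr_distlC.
Qed.

Theorem analytic_branches : (forall x k, analytic0 (fun h => (P (x + h))`_k)) ->
  (forall h, P h \is monic) -> (forall h, size (P h) = n.+1) -> (forall h, real_rooted (P h)) ->
  exists F : 'I_n -> R -> R, forall x,
    (forall k, analytic_at (F k) x) /\ P x = \prod_k ('X - (F k x)%:P).
Proof.
move=> HP mP sP rP; have [|F sF] := branch_system_global.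
  by move=> x; apply: branch_system_local.
by exists F => x; apply: sF.
Qed.

End Glue.

(** * The graded decomposition attached to the subspaces V_j *)

Section LinAlg.
Variable R : realType.

Lemma gram_eq0 m n (U : 'M[R]_(m, n)) : U *m U^T = 0 -> U = 0.
Proof.
move=> UU; apply/matrixP => i j; rewrite mxE; apply/eqP; rewrite -sqrf_eq0.
have := congr1 (fun M : 'M[R]_m => M i i) UU; rewrite !mxE => /eqP.
rewrite psumr_eq0 => [/allP/(_ j (mem_index_enum _))|k _]; last by rewrite mxE -expr2 sqr_ge0.
by rewrite mxE -expr2.
Qed.

Lemma gram_ge0 m n (U : 'M[R]_(m, n)) i : 0 <= (U *m U^T) i i.
Proof. by rewrite mxE; apply: sumr_ge0 => k _; rewrite mxE -expr2 sqr_ge0. Qed.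

(** * Orthogonal projections on row spaces *)

Section OrthProj.
Variables (d : nat) (V : 'M[R]_d).
Let W := orthmx V.
Let P := orthproj V.

Lemma orthmxP m (X : 'M[R]_(m, d)) : (X <= W)%MS <-> X *m V^T = 0.
Proof. by split=> [/sub_kermxP|h]; last apply/sub_kermxP. Qed.

Lemma orthmx_cap : (W :&: V)%MS = 0.
Proof.
set X := (W :&: V)%MS.
have /orthmxP XV : (X <= W)%MS by apply: capmxSl.
have /submxP[D XD] : (X <= V)%MS by apply: capmxSr.
by apply: gram_eq0; rewrite {2}XD trmx_mul mulmxA XV mul0mx.
Qed.

Lemma orthmx_full : (1%:M <= W + V)%MS.
Proof.
rewrite sub1mx /row_full eqn_leq rank_leq_col /=.
have := mxrank_sum_cap W V; rewrite orthmx_cap mxrank0 addn0 => ->.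
by rewrite /W /orthmx mxrank_ker mxrank_tr subnK // rank_leq_col.
Qed.

Lemma orthproj_id m (X : 'M[R]_(m, d)) : X *m V^T = 0 -> X *m P = X.
Proof. by move=> /orthmxP XW; apply: proj_mx_id => //; apply: orthmx_cap. Qed.

Lemma orthproj_0 m (X : 'M[R]_(m, d)) : (X <= V)%MS -> X *m P = 0.
Proof. by move=> XV; apply: proj_mx_0 => //; apply: orthmx_cap. Qed.

Lemma orthproj_orth : P *m V^T = 0.
Proof. by apply/orthmxP; rewrite -[P]mul1mx; apply: proj_mx_sub. Qed.

Lemma orthproj_compl : (1%:M - P <= V)%MS.
Proof.
have := proj_mx_compl_sub orthmx_full; rewrite mul1mx; exact.
Qed.

(** The rows of [1%:M - P] lie in [V] and those of [P] are orthogonal to [V], hence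
    [P = P *m P^T]. *)
Lemma orthproj_sym : P^T = P.
Proof.
have /submxP[D HD] := orthproj_compl.
have E : P *m (1%:M - P)^T = 0 by rewrite HD trmx_mul mulmxA orthproj_orth mul0mx.
have PE : P = P *m P^T.
  have tB : (1%:M - P)^T = 1%:M - P^T by rewrite [LHS]linearB /= trmx1.
  by apply/eqP; rewrite -subr_eq0 -[X in X - _]mulmx1 -mulmxBr -tB E.
by rewrite PE trmx_mul trmxK.
Qed.

Lemma rank_orthproj_compl : \rank (1%:M - P) = \rank V.
Proof.
apply/eqP; rewrite eqn_leq !mxrankS ?orthproj_compl //.
have -> : (V <= 1%:M - P)%MS = (V *m (1%:M - P) <= 1%:M - P)%MS.
  by rewrite mulmxBr mulmx1 orthproj_0 ?subr0.
exact: submxMl.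
Qed.

End OrthProj.

(** Writing [T = L *m E *m U], [T] is conjugate to [X = E *m U *m L]. Idempotence gives
    [X *m E = E], so [X] is block triangular with diagonal blocks 1 and 0. *)
Lemma det_idempotent n (T : 'M[R]_n) (c : R) : T *m T = T ->
  \det (1%:M + c *: T) = (1 + c) ^+ \rank T.
Proof.
move=> TT; pose E : 'M[R]_n := pid_mx (\rank T).
pose L := col_ebase T; pose U := row_ebase T.
have TE : L *m E *m U = T by apply: mulmx_ebase.
have uL : L \in unitmx by apply: col_ebase_unit.
have uU : U \in unitmx by apply: row_ebase_unit.
have EE : E *m E = E by rewrite /E pid_mx_id // rank_leq_row.
pose X := E *m U *m L.
have XE : X *m E = E.
  have : L *m (X *m E) *m U = L *m E *m U.
    by rewrite TE -[RHS]TT -TE /X !mulmxA.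
  by move/(can_inj (mulmxK uU))/(can_inj (mulKmx uL)).
have EX : E *m X = X by rewrite /X !mulmxA EE.
have -> : \det (1%:M + c *: T) = \det (1%:M + c *: X).
  have -> : 1%:M + c *: T = L *m (1%:M + c *: X) *m invmx L.
    rewrite mulmxDr mulmxDl mulmx1 mulmxV // -scalemxAr -scalemxAl /X -TE.
    by rewrite !mulmxA mulmxK.
  by rewrite !det_mulmx mulrAC -det_mulmx mulmxV // det1 mul1r.
clearbody X.
have Xij (i j : 'I_n) : (\rank T <= i)%N -> X i j = 0.
  move=> ri; rewrite -EX mxE big1 // => k _.
  by rewrite mxE ltnNge ri andbF mul0r.
have Xij' (i j : 'I_n) : (j < \rank T)%N -> X i j = E i j.
  move=> jr; rewrite -[in RHS]XE [RHS]mxE (bigD1 j) //= big1 ?addr0 => [|k kj].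
    by rewrite [E j j]mxE eqxx jr mulr1.
  by rewrite [E k j]mxE val_eqE (negPf kj) mulr0.
rewrite -det_tr det_trig; last first.
  apply/is_trig_mxP => i j ij; rewrite !mxE.
  have -> : (j == i) = false by apply/negbTE; rewrite -val_eqE /= gtn_eqF.
  have [rj|jr] := leqP (\rank T) j; first by rewrite Xij // mulr0 addr0.
  by rewrite Xij' ?(ltn_trans ij) // mxE gtn_eqF // mulr0 addr0.
transitivity (\prod_(i < n) (if (i < \rank T)%N then 1 + c else 1)).
  apply: eq_bigr => i _; rewrite !mxE eqxx; case: ltnP => ri.
    by rewrite Xij' // mxE eqxx ri mulr1.
  by rewrite Xij // mulr0 addr0.
rewrite -big_mkcond /= prodr_const; congr (_ ^+ _).
rewrite -sum1_card -(big_ord_widen _ (fun _ => 1%N)) ?sum1_card ?card_ord //.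
exact: rank_leq_row.
Qed.

(** * Layers and the rescaled matrix *)

Section Construction.
Variables (d : nat) (N : nat -> nat) (A : forall i : nat, 'M[R]_(N i, d)).

(* perp_proj j is the orthogonal projection P_(j-1), with P_(-1) = 1. *)
Definition perp_proj j : 'M[R]_d := if j is j'.+1 then orthproj (Vsp A j') else 1%:M.

Lemma AtA_sym i : (AtA A i)^T = AtA A i.
Proof. by rewrite /AtA trmx_mul trmxK. Qed.

Lemma perp_proj_sym j : (perp_proj j)^T = perp_proj j.
Proof. by case: j => [|j]; [apply: trmx1|apply: orthproj_sym]. Qed.

Lemma AhatE j : Ahat A j = perp_proj j *m AtA A j *m perp_proj j.
Proof. by case: j => [|j] //=; rewrite mul1mx mulmx1. Qed.

Lemma Ahat_sym j : (Ahat A j)^T = Ahat A j.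
Proof. by rewrite AhatE trmx_mul trmx_mul perp_proj_sym AtA_sym mulmxA. Qed.

Lemma VspS j : (Vsp A j <= Vsp A j.+1)%MS.
Proof. exact: addsmxSl. Qed.

Lemma Vsp_le i j : (i <= j)%N -> (Vsp A i <= Vsp A j)%MS.
Proof.
by move=> /subnK <-; elim: (j - i)%N => // k IH; rewrite addSn (submx_trans IH) // VspS.
Qed.

Lemma Ahat_sub j : (Ahat A j <= Vsp A j)%MS.
Proof. by case: j => [|j] //=; apply: addsmxSr. Qed.

Lemma perp_proj_mul a b : (a <= b)%N -> perp_proj b *m perp_proj a = perp_proj b.
Proof.
case: a => [|a]; first by rewrite mulmx1.
case: b => [|b] // ab; apply: orthproj_id.
have /submxP[D ->] : (Vsp A a <= Vsp A b)%MS by apply: Vsp_le.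
by rewrite trmx_mul mulmxA orthproj_orth mul0mx.
Qed.

Lemma perp_proj_mulC a b : (a <= b)%N -> perp_proj a *m perp_proj b = perp_proj b.
Proof. by move=> ab; rewrite -[LHS]trmxK trmx_mul !perp_proj_sym perp_proj_mul // perp_proj_sym. Qed.

Lemma Ahat_perp_projS j : Ahat A j *m perp_proj j.+1 = 0.
Proof. exact: orthproj_0 (Ahat_sub j). Qed.

(** The Gram matrix of [A i *m perp_proj i.+1] is [Ahat A i] compressed by [perp_proj i.+1], which
    is 0 because the image of [Ahat A i] lies in [Vsp A i]. *)
Lemma A_perp_proj_eq0 i j : (i < j)%N -> A i *m perp_proj j = 0.
Proof.
move=> ij.
suff E : A i *m perp_proj i.+1 = 0 by rewrite -(perp_proj_mulC ij) mulmxA E mul0mx.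
apply/trmx_inj; rewrite trmx0; apply: gram_eq0.
rewrite trmxK trmx_mul perp_proj_sym mulmxA -(mulmxA (perp_proj i.+1)) -/(AtA A i).
rewrite -{1}(perp_proj_mul (leqnSn i)) -{2}(perp_proj_mulC (leqnSn i)).
have -> : perp_proj i.+1 *m perp_proj i *m AtA A i *m (perp_proj i *m perp_proj i.+1) =
  perp_proj i.+1 *m (perp_proj i *m AtA A i *m perp_proj i *m perp_proj i.+1) by rewrite !mulmxA.
by rewrite -AhatE Ahat_perp_projS mulmx0.
Qed.

Lemma AtA_perp_proj_eq0 i j : (i < j)%N -> AtA A i *m perp_proj j = 0.
Proof. by move=> ij; rewrite -mulmxA A_perp_proj_eq0 // mulmx0. Qed.

Lemma perp_proj_AtA_eq0 i j : (i < j)%N -> perp_proj j *m AtA A i = 0.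
Proof.
by move=> ij; apply: trmx_inj; rewrite trmx_mul perp_proj_sym AtA_sym AtA_perp_proj_eq0 // trmx0.
Qed.

Lemma rank_perp_proj_compl j : \rank (1%:M - perp_proj j) = nprev A j.
Proof.
case: j => [|j] /=; first by rewrite subrr mxrank0.
exact: rank_orthproj_compl.
Qed.

Lemma Ahat_gram j : Ahat A j = (A j *m perp_proj j)^T *m (A j *m perp_proj j).
Proof. by rewrite AhatE trmx_mul perp_proj_sym /AtA !mulmxA. Qed.

Local Opaque AtA.

(** Each column of [perp_proj r.+1] lies in the common kernel of the [A i]. *)
Lemma perp_proj_last r :
  (forall x : 'cV[R]_d, (forall i : nat, (i <= r)%N -> A i *m x = 0) -> x = 0) ->
  perp_proj r.+1 = 0.
Proof.
move=> hx; apply/matrixP => i k; rewrite [RHS]mxE.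
have -> : perp_proj r.+1 i k = (col k (perp_proj r.+1)) i 0 by rewrite [RHS]mxE.
rewrite (hx (col k (perp_proj r.+1))) ?mxE // => l lr.
by rewrite colE mulmxA A_perp_proj_eq0 // mul0mx.
Qed.

(** The orthogonal projection onto the complement of V_(a-1) in V_a. *)
Definition layer_proj a := perp_proj a - perp_proj a.+1.

Lemma layer_proj_idem a : layer_proj a *m layer_proj a = layer_proj a.
Proof.
rewrite /layer_proj mulmxBl !mulmxBr.
by rewrite (perp_proj_mul (leqnn a)) (perp_proj_mulC (leqnSn a)) (perp_proj_mul (leqnSn a))
  (perp_proj_mul (leqnn a.+1)) subrr subr0.
Qed.

Lemma layer_proj_mul_eq0 a b : a != b -> layer_proj a *m layer_proj b = 0.
Proof.
rewrite /layer_proj mulmxBl !mulmxBr neq_ltn => /orP[ab|ba].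
  by rewrite !perp_proj_mulC ?subrr //; lia.
by rewrite !perp_proj_mul ?subrr //; lia.
Qed.

Lemma sum_layer_proj n : \sum_(a < n) layer_proj a = 1%:M - perp_proj n.
Proof.
elim: n => [|n IH]; first by rewrite big_ord0 subrr.
by rewrite big_ord_recr /= IH /layer_proj addrA subrK.
Qed.

Lemma layer_proj_AtA_eq0 a i : (i < a)%N -> layer_proj a *m AtA A i = 0.
Proof. by move=> ia; rewrite mulmxBl !perp_proj_AtA_eq0 ?subrr // ltnW. Qed.

Lemma AtA_layer_proj_eq0 a i : (i < a)%N -> AtA A i *m layer_proj a = 0.
Proof. by move=> ia; rewrite mulmxBr !AtA_perp_proj_eq0 ?subrr // ltnW. Qed.

Lemma layer_proj_AtA_layer_proj i : layer_proj i *m AtA A i *m layer_proj i = Ahat A i.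
Proof.
have e : layer_proj i *m AtA A i = perp_proj i *m AtA A i by rewrite [LHS]mulmxBl (perp_proj_AtA_eq0 (ltnSn i)) subr0.
by rewrite AhatE e [LHS]mulmxBr -(mulmxA _ _ (perp_proj i.+1)) AtA_perp_proj_eq0 // mulmx0 subr0.
Qed.

Variables (r : nat).
Hypothesis hA : forall x : 'cV[R]_d, (forall i : nat, (i <= r)%N -> A i *m x = 0) -> x = 0.

Lemma ndim_full : ndim A r = d.
Proof. by have := rank_perp_proj_compl r.+1; rewrite (perp_proj_last hA) subr0 mxrank1 => /esym. Qed.

Lemma sum_layer_proj1 : \sum_(a < r.+1) layer_proj a = 1%:M.
Proof. by rewrite sum_layer_proj (perp_proj_last hA) subr0. Qed.

Variable j : nat.
Let w a := minn a j.

Definition Escale (t : R) := \sum_(a < r.+1) t ^+ w a *: layer_proj a.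

(* Mscaled is E^-1 (h^(2j) y - A_h) E^-1 for E = Escale, in a form that is
   polynomial in h. The exponents are truncated only where A_l kills layer
   a or b. *)
Definition Mscaled (t y : R) :=
  \sum_(a < r.+1) (y * t ^+ (2 * (j - w a))) *: layer_proj a
  - \sum_(l < r.+1) \sum_(a < r.+1) \sum_(b < r.+1)
      t ^+ (2 * l - w a - w b) *: (layer_proj a *m AtA A l *m layer_proj b).

Lemma Escale_layer_proj t (a : 'I_r.+1) : Escale t *m layer_proj a = t ^+ w a *: layer_proj a.
Proof.
rewrite /Escale mulmx_suml (bigD1 a isT) -(scalemxAl _ (layer_proj a) (layer_proj a)) layer_proj_idem big1 => [|b ba].
  exact: addr0.
by rewrite -scalemxAl layer_proj_mul_eq0 ?scaler0.
Qed.

Lemma layer_proj_Escale t (a : 'I_r.+1) : layer_proj a *m Escale t = t ^+ w a *: layer_proj a.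
Proof.
rewrite /Escale mulmx_sumr (bigD1 a isT) -(scalemxAr _ (layer_proj a) (layer_proj a)) layer_proj_idem big1 => [|b ba].
  exact: addr0.
by rewrite -scalemxAr layer_proj_mul_eq0 ?scaler0 // eq_sym.
Qed.

Lemma det_Escale_neq0 t : t != 0 -> \det (Escale t) != 0.
Proof.
move=> t0; have : Escale t *m (\sum_(a < r.+1) t ^- w a *: layer_proj a) = 1%:M.
  rewrite mulmx_sumr -sum_layer_proj1; apply: eq_bigr => a _.
  by rewrite -scalemxAr Escale_layer_proj scalerA mulVf ?scale1r // expf_neq0.
move/(congr1 determinant); rewrite det_mulmx det1 => E; apply/eqP => E0.
by move: E; rewrite E0 mul0r => /eqP; rewrite eq_sym oner_eq0.
Qed.

Lemma Mscaled_conj t y :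
  Escale t *m Mscaled t y *m Escale t = (t ^+ (2 * j) * y)%:M - Acal A r t.
Proof.
move: (Escale t) (Escale_layer_proj t) (layer_proj_Escale t) => E EP PE.
rewrite /Mscaled mulmxBr mulmxBl; congr (_ - _).
  rewrite -scalemx1 -sum_layer_proj1 scaler_sumr mulmx_sumr mulmx_suml; apply: eq_bigr => a _.
  rewrite -scalemxAr EP -!scalemxAl PE !scalerA; congr (_ *: _).
  have -> : (2 * j)%N = (2 * (j - w a) + w a + w a)%N by rewrite /w; lia.
  by rewrite !exprD; ring.
rewrite /Acal mulmx_sumr mulmx_suml; apply: eq_bigr => l _.
have AE : AtA A l = \sum_(a < r.+1) \sum_(b < r.+1) layer_proj a *m AtA A l *m layer_proj b.
  rewrite -[LHS]mul1mx -sum_layer_proj1 mulmx_suml; apply: eq_bigr => a _.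
  by rewrite -[LHS]mulmx1 -sum_layer_proj1 mulmx_sumr.
rewrite [in RHS]AE scaler_sumr mulmx_sumr mulmx_suml; apply: eq_bigr => a _.
rewrite scaler_sumr mulmx_sumr mulmx_suml; apply: eq_bigr => b _.
move: (@layer_proj_AtA_eq0 a l) (@AtA_layer_proj_eq0 b l); move: (AtA A l) => B zl zr.
rewrite -scalemxAr !mulmxA EP -!scalemxAl -!mulmxA PE -!scalemxAr !scalerA.
have [la|al] := ltnP l a; first by rewrite mulmxA zl // mul0mx !scaler0.
have [lb|bl] := ltnP l b; first by rewrite zr // mulmx0 !scaler0.
congr (_ *: _).
have -> : (2 * l)%N = (2 * l - w a - w b + w a + w b)%N by rewrite /w; lia.
rewrite !exprD; have -> : (2 * l - w a - w b + w a + w b - w a - w b)%N = (2 * l - w a - w b)%N by lia.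
ring.
Qed.

(** Only exponents equal to 0 survive at [t = 0]. In the second sum, nonzero blocks have a, b <= l,
    and [2 * l <= w a + w b] then forces a = b = l <= j, which leaves [Ahat A l]. *)
Lemma Mscaled0 y : (j <= r.+1)%N ->
  Mscaled 0 y = y *: perp_proj j - \sum_(l < j) Ahat A l - Ahat A j.
Proof.
move=> jr; rewrite -addrA -opprD /Mscaled; congr (_ - _).
  have -> : perp_proj j = \sum_(a < r.+1 | (j <= a)%N) layer_proj a.
    apply/eqP; rewrite -subr_eq0 -[perp_proj j](subKr 1%:M) -sum_layer_proj -sum_layer_proj1.
    rewrite (big_ord_widen _ layer_proj jr) [X in X - _ - _](bigID (fun a : 'I_r.+1 => (a < j)%N)) /=.
    rewrite [X in X - _]addrAC subrr add0r subr_eq0; apply/eqP; apply: eq_bigl => a; by rewrite -leqNgt.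
  rewrite scaler_sumr [RHS]big_mkcond; apply: eq_bigr => a _ /=.
  rewrite expr0n /w; case: leqP => ja.
    by rewrite subnn muln0 eqxx mulr1.
  have -> : (2 * (j - a) == 0)%N = false by apply/eqP; lia.
  by rewrite mulr0 scale0r.
(* For [j = r.+1] the right side has the term [Ahat A r.+1], to which no summand of [Mscaled]
   corresponds. *)
have Alast : Ahat A r.+1 = 0 by rewrite AhatE (perp_proj_last hA) mulmx0.
transitivity (\sum_(l < r.+2 | (l <= j)%N) Ahat A l); last first.
  rewrite -(big_ord_recr j (fun l => Ahat A l)) /= (big_ord_widen r.+2 (fun l => Ahat A l)) //.
move: Alast => /= Alast.
rewrite [RHS]big_mkcond [RHS]big_ord_recr /= Alast if_same addr0; apply: eq_bigr => l _.
pose F (a b : 'I_r.+1) := 0 ^+ (2 * l - w a - w b) *: (layer_proj a *m AtA A l *m layer_proj b).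
have Fll : F l l = if (l <= j)%N then Ahat A l else 0.
  rewrite /F layer_proj_AtA_layer_proj expr0n /w; case: leqP => lj.
    have -> : (2 * l - l - l)%N = 0%N by lia.
    by rewrite scale1r.
  have -> : (2 * l - j - j == 0)%N = false by apply/eqP; lia.
  by rewrite scale0r.
have F0 (a b : 'I_r.+1) : (a != l) || (b != l) -> F a b = 0.
  rewrite -!val_eqE /= => abl; rewrite /F.
  have [la|al] := ltnP l a; first by rewrite layer_proj_AtA_eq0 // mul0mx scaler0.
  have [lb|bl] := ltnP l b; first by rewrite -mulmxA AtA_layer_proj_eq0 // mulmx0 scaler0.
  rewrite expr0n; have -> : (2 * l - w a - w b == 0)%N = false; last by rewrite scale0r.
  by apply/eqP; rewrite /w; move: abl al bl; lia.
transitivity (\sum_a \sum_b F a b) => //.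
rewrite -Fll (bigD1 l isT) /= [X in _ + X]big1 => [|a al].
  rewrite addr0 (bigD1 l isT) /= big1 ?addr0 // => b bl.
  by rewrite F0 // bl orbT.
by rewrite big1 // => b _; rewrite F0 // al.
Qed.

(** V_(n-1) is the sum of the images of the symmetric [Ahat A l] with l < n, so the common kernel of
    these is its orthogonal complement. *)
Lemma perp_proj_fix m (v : 'M[R]_(m, d)) n : (forall l, (l < n)%N -> v *m Ahat A l = 0) -> v *m perp_proj n = v.
Proof.
elim: n => [|n IH] Hv; first by rewrite mulmx1.
have vn : v *m perp_proj n = v by apply: IH => l ln; apply: Hv; apply: ltnW.
apply: orthproj_id.
have vA : v *m (Ahat A n)^T = 0 by rewrite Ahat_sym Hv.
case: n vn vA {IH Hv} => [|n] vn vA //.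
have vV : v *m (Vsp A n)^T = 0 by rewrite -vn -mulmxA orthproj_orth mulmx0.
have key B : v *m B^T = 0 -> (Vsp A n.+1 <= Vsp A n + B)%MS -> v *m (Vsp A n.+1)^T = 0.
  move=> vB /sub_addsmxP[[D1 D2] /= ->].
  by rewrite linearD /= (trmx_mul D1) (trmx_mul D2) mulmxDr !mulmxA vV vB !mul0mx addr0.
exact: key vA _.
Qed.

Lemma Ahat_perp_proj a b : (b <= a)%N -> Ahat A a *m perp_proj b = Ahat A a.
Proof. by move=> ba; rewrite AhatE -!mulmxA perp_proj_mul. Qed.

Lemma Ahat_perp_proj0 a b : (a < b)%N -> Ahat A a *m perp_proj b = 0.
Proof.
move=> ab; rewrite AhatE; move: (AtA_perp_proj_eq0 ab); move: (AtA A a) => B HB.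
by rewrite -!mulmxA perp_proj_mulC ?(ltnW ab) // HB mulmx0.
Qed.

Lemma perp_proj_Ahat0 a b : (a < b)%N -> perp_proj b *m Ahat A a = 0.
Proof.
move=> ab; rewrite AhatE; move: (perp_proj_AtA_eq0 ab); move: (AtA A a) => B HB.
by rewrite !mulmxA perp_proj_mul ?(ltnW ab) // HB mul0mx.
Qed.

(** The matrix is the identity on the complement of V_(j-1) and, up to sign, the sum of the positive
    semidefinite [Ahat A l] on V_(j-1). A kernel vector is killed by [perp_proj j] and by each
    [Ahat A l], and [perp_proj_fix] makes it 0. *)
Lemma det_base_neq0 : \det (perp_proj j - \sum_(l < j) Ahat A l) != 0.
Proof.
apply/negP => /det0P[v v0]; rewrite mulmxBr => vE.
have CS : (\sum_(l < j) Ahat A l) *m perp_proj j = 0.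
  by rewrite mulmx_suml big1 // => l _; rewrite Ahat_perp_proj0.
have vS : v *m perp_proj j = 0.
  by have := congr1 (mulmx^~ (perp_proj j)) vE; rewrite mulmxBl -!mulmxA CS mulmx0 subr0 mul0mx perp_proj_mul.
have vC : v *m (\sum_(l < j) Ahat A l) = 0.
  by move/eqP: vE; rewrite vS sub0r oppr_eq0 => /eqP.
have G l : v *m Ahat A l *m v^T = (v *m (A l *m perp_proj l)^T) *m (v *m (A l *m perp_proj l)^T)^T.
  have T (G : 'M[R]_(N l, d)) : (v *m G^T)^T = G *m v^T by rewrite trmx_mul trmxK.
  by rewrite Ahat_gram T !mulmxA.
case/negP: v0; rewrite -(@perp_proj_fix _ v j) ?vS // => l lj.
have : (v *m (\sum_(l < j) Ahat A l) *m v^T) 0 0 = 0 by rewrite vC mul0mx mxE.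
rewrite mulmx_sumr mulmx_suml summxE => /eqP; rewrite psumr_eq0 => [|i _]; last first.
  by rewrite G gram_ge0.
move=> /allP/(_ (Ordinal lj) (mem_index_enum _)) /=; rewrite G => /eqP g0.
have : v *m (A l *m perp_proj l)^T = 0.
  by apply: gram_eq0; apply/matrixP => a b; rewrite !ord1 g0 mxE.
by move=> g1; rewrite Ahat_gram mulmxA g1 mul0mx.
Qed.

(** Separates the block on V_(j-1), free of [y], from the block y - Ahat_j on its complement; each
    is completed by the identity on the other subspace. *)
Lemma det_Mscaled0 y : (j <= r.+1)%N ->
  \det (Mscaled 0 y) = \det (y *: perp_proj j + (1%:M - perp_proj j - Ahat A j)) *
    \det (perp_proj j - \sum_(l < j) Ahat A l).
Proof.
move=> jr; rewrite Mscaled0 // -det_mulmx; congr (\det _).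
set S := perp_proj j; set C := \sum_(l < j) _; set B := Ahat A j.
have SC : S *m C = 0 by rewrite mulmx_sumr big1 // => l _; rewrite perp_proj_Ahat0.
have SS : S *m S = S by rewrite perp_proj_mul.
have BS : B *m S = B by rewrite Ahat_perp_proj.
have BC : B *m C = 0 by rewrite -BS -mulmxA SC mulmx0.
rewrite mulmxDl !mulmxBl !mulmxBr -!scalemxAl !mul1mx SC SS BS BC scaler0 !subr0.
by rewrite [S - C - S]addrAC subrr sub0r addrA.
Qed.

(** The second factor is the determinant of multiplication by [y] on V_(j-1) and by 1 on its
    complement. *)
Lemma det_char_Ahat y :
  \det (y%:M - Ahat A j) = \det (y *: perp_proj j + (1%:M - perp_proj j - Ahat A j)) * y ^+ nprev A j.
Proof.
set S := perp_proj j; set B := Ahat A j.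
have SS : S *m S = S by rewrite perp_proj_mul.
have BS : B *m S = B by rewrite Ahat_perp_proj.
have idT : (1%:M - S) *m (1%:M - S) = 1%:M - S.
  by rewrite mulmxBl !mulmxBr !mul1mx mulmx1 SS subrr subr0.
have -> : y ^+ nprev A j = \det (1%:M + (y - 1) *: (1%:M - S)).
  by rewrite det_idempotent // rank_perp_proj_compl addrC subrK.
rewrite -det_mulmx; congr (\det _).
rewrite mulmxDr mulmx1 -scalemxAr mulmxDl -scalemxAl mulmxBr mulmx1 SS subrr scaler0 add0r.
rewrite mulmxBl idT mulmxBr mulmx1 BS subrr subr0.
rewrite -scalemx1; apply/matrixP => i k; rewrite !mxE; ring.
Qed.

End Construction.

End LinAlg.

(** * Leading terms of the eigenbranches *)

Section Final.
Variable R : realType.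

Lemma poly_nonroot (p : {poly R}) : p != 0 -> exists y, p.[y] != 0.
Proof.
move=> p0; apply: contrapT => H.
have : (size [seq i%:R : R | i <- iota 0 (size p)] < size p)%N.
  apply: max_poly_roots => //.
    by apply/allP => x _; apply/rootP/eqP/negPn/negP => hx; apply: H; exists x.
  by rewrite map_inj_uniq ?iota_uniq // => i j /eqP; rewrite eqr_nat => /eqP.
by rewrite size_map size_iota ltnn.
Qed.

Lemma poly_horner_inj (p q : {poly R}) : (forall y, p.[y] = q.[y]) -> p = q.
Proof.
move=> pq; apply/eqP; rewrite -subr_eq0; apply/negPn/negP => /poly_nonroot[y].
by rewrite hornerD hornerN pq subrr eqxx.
Qed.

Definition pencil n (X Y : 'M[R]_n) : {poly R} :=
  \det ('X *: map_mx polyC X + map_mx polyC Y).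

Lemma horner_pencil n (X Y : 'M[R]_n) y : (pencil X Y).[y] = \det (y *: X + Y).
Proof.
rewrite /pencil -[LHS]/(horner_eval y _) -det_map_mx; congr (\det _).
by apply/matrixP => i j; rewrite !mxE /= /horner_eval hornerD hornerM hornerX !hornerC.
Qed.

Lemma horner_char_poly n (X : 'M[R]_n) y : (char_poly X).[y] = \det (y%:M - X).
Proof.
rewrite /char_poly -[LHS]/(horner_eval y _) -det_map_mx; congr (\det _).
apply/matrixP => i j; by rewrite !mxE /= /horner_eval hornerD hornerN hornerMn hornerX hornerC.
Qed.

Lemma analytic0_det n (F : R -> 'M[R]_n) : (forall i j, analytic0 (fun t => F t i j)) -> analytic0 (fun t => \det (F t)).
Proof.
move=> HF; apply: analytic0_sum => s _; apply: analytic0M; first exact: analytic0_cst.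
by apply: analytic0_prod => i _; apply: HF.
Qed.

(** The factorization at 0 holds on the whole line, and away from 0 the cofactor is the quotient of
    [f] by a power of [t], hence analytic there too. *)
Lemma analytic0_even_order (f : R -> R) : (forall x, analytic_at f x) -> (forall t, 0 <= f t) ->
  (forall t, t != 0 -> f t != 0) ->
  exists m e, [/\ forall x, analytic_at e x, e 0 != 0 & forall t, f t = t ^+ (2 * m) * e t].
Proof.
move=> Hf f0 fn0.
have f00 : analytic0 f by apply: analytic0_eq (Hf 0) => y; rewrite add0r.
case: (analytic0_order f00) => [z|[p [u [Hu u0 fu]]]].
  have [x [x0 fx _]] := near0_pos z.
  by have := fn0 x; rewrite gt_eqF // fx eqxx => /(_ isT).
have evp : ~~ odd p by apply: (analytic0_nonneg_even_order Hu u0 fu); apply: filterS filterT.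
exists p./2, u; split=> // [x|t]; last by rewrite fu mul2n -[in LHS](odd_double_half p) (negPf evp).
have [->|x0] := eqVneq x 0.
  by apply: analytic0_eq Hu => y; rewrite add0r.
have xn : \forall y \near (0 : R), x + y != 0.
  apply: analytic0_near_neq0; first by apply: analytic0D (analytic0_cst _) (@analytic0_id R).
  by rewrite addr0.
apply: analytic0_ext (analytic0M (Hf x) (analytic0X p (analytic0_inv x0))).
apply: filterS xn => y xy.
by rewrite fu mulrAC -exprMn mulfV // expr1n mul1r.
Qed.

Lemma analytic_at_real_analytic (f : R -> R) : (forall x, analytic_at f x) -> real_analytic f.
Proof.
move=> Hf x; have [a Ha] := Hf x; have [e e0 He] := has_ps_cvg Ha.
exists a, e; split=> // y xy; have := He _ xy.
by have -> : x + (y - x) = y by rewrite addrC subrK.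
Qed.

Lemma count_enum (T : finType) (B C : pred T) : count C (enum B) = #|[pred k | B k && C k]|.
Proof.
rewrite -sum1_count big_enum_cond -sum1_card; apply: eq_bigl => k.
by rewrite !inE.
Qed.

Lemma prod_const_XsubC (T : finType) (B : pred T) (e : T -> R) :
  \prod_(k | B k) ('X - (e k)%:P) = \prod_(x <- map e (enum B)) ('X - x%:P).
Proof.
by rewrite big_map big_enum.
Qed.

(** * Counting branches by their order at 0 *)

Section Count.
Variables (d r : nat) (N : nat -> nat) (A : forall i : nat, 'M[R]_(N i, d)).
Hypothesis hA : forall x : 'cV[R]_d, (forall i : nat, (i <= r)%N -> A i *m x = 0) -> x = 0.
Variables (m : 'I_d -> nat) (eta : 'I_d -> R -> R).
Hypothesis Heta : forall k, analytic0 (eta k).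
Hypothesis eta0 : forall k, eta k 0 != 0.
Hypothesis Hchar : forall t, char_poly (Acal A r t) = \prod_k ('X - (t ^+ (2 * m k) * eta k t)%:P).

Variable j : nat.
Hypothesis jr : (j <= r.+1)%N.

Let mn k := minn (m k) j.
(** The product of the [t ^+ (2 * j) * y - t ^+ (2 * m k) * eta k t], with the common power of [t]
    taken out of each factor so that none vanishes identically in [y] at [t = 0]. *)
Let Rt t y := \prod_k (t ^+ (2 * (j - mn k)) * y - t ^+ (2 * (m k - mn k)) * eta k t).
Let D t y := \det (Mscaled A r j t y).

Lemma analytic0_Rt y : analytic0 (Rt^~ y).
Proof.
apply: analytic0_prod => k _; apply: analytic0B; first by apply: analytic0M (analytic0_cst _); apply: analytic0X (@analytic0_id R).
by apply: analytic0M => //; apply: analytic0X (@analytic0_id R).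
Qed.

Lemma analytic0_D y : analytic0 (D^~ y).
Proof.
apply: analytic0_det => i k; rewrite /Mscaled.
apply: (analytic0_eq (f := fun t => \sum_(a < r.+1) (y * t ^+ (2 * (j - minn a j))) * (layer_proj A a) i k
  - \sum_(l < r.+1) \sum_(a < r.+1) \sum_(b < r.+1)
      t ^+ (2 * l - minn a j - minn b j) * (layer_proj A a *m AtA A l *m layer_proj A b) i k)).
  move=> t; rewrite [RHS]mxE [in RHS]mxE !summxE; congr (_ - _).
    by apply: eq_bigr => a _; rewrite [RHS]mxE.
  apply: eq_bigr => l _; rewrite summxE; apply: eq_bigr => a _; rewrite summxE; apply: eq_bigr => b _.
  by rewrite [RHS]mxE.
have Xn n : analytic0 (fun t : R => t ^+ n) by apply: analytic0X (@analytic0_id R).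
apply: analytic0B; first by apply: analytic0_sum => a _; apply: analytic0M (analytic0_cst _); apply: analytic0M (analytic0_cst _) _.
by do 3 (apply: analytic0_sum => ? _); apply: analytic0M (analytic0_cst _).
Qed.

Lemma scaled_det t y : \det (Escale A r j t) ^+ 2 * D t y = (\prod_k t ^+ (2 * mn k)) * Rt t y.
Proof.
have := congr1 (fun X => \det X) (Mscaled_conj hA j t y); rewrite !det_mulmx => E.
have -> : \det (Escale A r j t) ^+ 2 * D t y = (char_poly (Acal A r t)).[t ^+ (2 * j) * y].
  by rewrite horner_char_poly -E /D; ring.
rewrite Hchar horner_prod /Rt -big_split; apply: eq_bigr => k _ /=.
rewrite hornerXsubC mulrBr !mulrA -!exprD; congr (_ ^+ _ * _ - _ ^+ _ * _); rewrite /mn; lia.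
Qed.

(** The prefactors of [scaled_det] do not depend on [y], so comparing two values of [y] eliminates
    them; what remains makes sense at [t = 0]. *)
Lemma scaled_det_cross t y y0 : t != 0 -> Rt t y * D t y0 = Rt t y0 * D t y.
Proof.
move=> t0; have h1 := scaled_det t y; have h2 := scaled_det t y0.
have E0 : \det (Escale A r j t) ^+ 2 != 0 by rewrite expf_neq0 // det_Escale_neq0.
have P0 : \prod_k t ^+ (2 * mn k) != 0 by apply/prodf_neq0 => k _; rewrite expf_neq0.
apply: (mulfI (mulf_neq0 E0 P0)).
transitivity ((\prod_k t ^+ (2 * mn k) * Rt t y) * (\det (Escale A r j t) ^+ 2 * D t y0)); first by ring.
rewrite -h1 h2; ring.
Qed.

Let e k := if m k == j then eta k 0 else 0.

(* The characteristic polynomial of Ahat_j on the complement of V_(j-1). *)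
Definition reduced_char_poly := pencil (perp_proj A j) (1%:M - perp_proj A j - Ahat A j).

Lemma char_Ahat : char_poly (Ahat A j) = reduced_char_poly * 'X^(nprev A j).
Proof.
apply: poly_horner_inj => y; rewrite hornerM hornerXn horner_pencil horner_char_poly.
exact: det_char_Ahat.
Qed.

(** At [t = 0] the factors of [Rt] with m < j become the nonzero constants [- eta k 0], those with m
    = j become y - eta(0), and those with m > j become y. The constant [c] is read off at a point
    [y0] where neither polynomial vanishes. *)
Lemma reduced_char_poly_branches : exists2 c, c != 0 & reduced_char_poly = c *: \prod_(k | (j <= m k)%N) ('X - (e k)%:P).
Proof.
pose q := \prod_(k | (j <= m k)%N) ('X - (e k)%:P).
pose c0 := \prod_(k | ~~ (j <= m k)%N) (- eta k 0).
have c00 : c0 != 0 by apply/prodf_neq0 => k _; rewrite oppr_eq0.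
have R0 y : Rt 0 y = q.[y] * c0.
  rewrite /Rt (bigID (fun k => (j <= m k)%N)) /=; congr (_ * _).
    rewrite /q horner_prod; apply: eq_bigr => k jm.
    rewrite hornerXsubC /e /mn (minn_idPr jm) subnn muln0 expr0 mul1r.
    case: eqVneq => [->|mj]; first by rewrite subnn muln0 expr0 mul1r.
    by rewrite expr0n; have -> : (2 * (m k - j) == 0)%N = false; [apply/eqP; lia|rewrite mul0r].
  apply: eq_bigr => k; rewrite -ltnNge => mj.
  rewrite /mn (minn_idPl (ltnW mj)) subnn muln0 expr0 mul1r expr0n.
  by have -> : (2 * (j - m k) == 0)%N = false; [apply/eqP; lia|rewrite mul0r sub0r].
pose g := \det (perp_proj A j - \sum_(l < j) Ahat A l).
have g0 : g != 0 by apply: det_base_neq0.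
have D0 y : D 0 y = reduced_char_poly.[y] * g by rewrite /D det_Mscaled0 // horner_pencil.
have cr y y0 : Rt 0 y * D 0 y0 = Rt 0 y0 * D 0 y.
  apply: (@analytic0_eq0 R (fun t => Rt t y * D t y0) (fun t => Rt t y0 * D t y)).
  - by apply: analytic0M; [apply: analytic0_Rt|apply: analytic0_D].
  - by apply: analytic0M; [apply: analytic0_Rt|apply: analytic0_D].
  - by apply: filterS filterT => t _ t0; apply: scaled_det_cross.
have q0 : q != 0 by apply: monic_neq0; apply: monic_prod_XsubC.
have psi0 : reduced_char_poly != 0.
  apply: contraTneq (char_poly_monic (Ahat A j)) => z.
  by rewrite char_Ahat z mul0r monicE lead_coef0 eq_sym oner_eq0.
have [y0] := poly_nonroot (mulf_neq0 psi0 q0).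
rewrite hornerM mulf_eq0 negb_or => /andP[py qy].
exists (reduced_char_poly.[y0] / q.[y0]); first by rewrite mulf_neq0 // invr_eq0.
apply: poly_horner_inj => y; rewrite hornerZ.
have := cr y y0; rewrite !R0 !D0 => E.
apply: (mulIf g0); apply: (mulIf c00); apply: (mulIf qy).
transitivity (q.[y0] * c0 * (reduced_char_poly.[y] * g)); first by ring.
by rewrite -E; field.
Qed.

(** Comparison of degrees in [char_Ahat]. *)
Lemma count_ge : (#|[pred k | (j <= m k)%N]| + nprev A j)%N = d.
Proof.
have [c c0 pE] := reduced_char_poly_branches.
have := size_char_poly (Ahat A j); rewrite char_Ahat pE prod_const_XsubC.
rewrite -scalerAl size_scale // size_monicM ?monic_prod_XsubC ?monic_neq0 ?monicXn //.
by rewrite size_prod_XsubC size_polyXn size_map -cardE addnS => -[].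
Qed.

(** Since [mu != 0], neither the power of 'X nor the branches with m > j, whose root is 0,
    contribute to the multiplicity. *)
Lemma count_eigen mu : mu != 0 ->
  #|[pred k | (m k == j) && (eta k 0 == mu)]| = mup mu (char_poly (Ahat A j)).
Proof.
move=> mu0; have [c c0 pE] := reduced_char_poly_branches.
rewrite char_Ahat mupMl; last by rewrite rootE hornerXn expf_neq0.
rewrite pE -mul_polyC mupMr; last by rewrite rootC.
rewrite prod_const_XsubC mu_prod_XsubC count_map count_enum.
apply: eq_card => k; rewrite !inE /e.
case: eqVneq => [->|mj] /=; first by rewrite leqnn.
by rewrite eq_sym (negPf mu0) andbF.
Qed.

End Count.

(** * Positivity and analyticity of the family *)

Section PSD.
Variables (d r : nat) (N : nat -> nat) (A : forall i : nat, 'M[R]_(N i, d)).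
Hypothesis hA : forall x : 'cV[R]_d, (forall i : nat, (i <= r)%N -> A i *m x = 0) -> x = 0.

Lemma Acal_sym t : (Acal A r t)^T = Acal A r t.
Proof.
rewrite /Acal linear_sum; apply: eq_bigr => i _.
by rewrite linearZ /= AtA_sym.
Qed.

Lemma Acal_form t (v : 'rV[R]_d) : (v *m Acal A r t *m v^T) 0 0 =
  \sum_(i < r.+1) t ^+ (2 * i) * ((v *m (A i)^T) *m (v *m (A i)^T)^T) 0 0.
Proof.
rewrite /Acal mulmx_sumr mulmx_suml summxE; apply: eq_bigr => i _.
by rewrite -scalemxAr -scalemxAl mxE trmx_mul trmxK /AtA !mulmxA.
Qed.

(** The quadratic form is a sum of squares with even powers of [t], so nonnegative for either sign
    of [t]; for [t != 0] an eigenvector of eigenvalue 0 would lie in the common kernel. *)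
Lemma Acal_root t x : root (char_poly (Acal A r t)) x -> 0 <= x /\ (t != 0 -> x != 0).
Proof.
rewrite -eigenvalue_root_char => /eigenvalueP[v vA v0].
have sq0 (i : 'I_r.+1) : 0 <= t ^+ (2 * i) * ((v *m (A i)^T) *m (v *m (A i)^T)^T) 0 0.
  by rewrite mulr_ge0 ?gram_ge0 // exprM exprn_ge0 // sqr_ge0.
have E : x * (v *m v^T) 0 0 =
    \sum_(i < r.+1) t ^+ (2 * i) * ((v *m (A i)^T) *m (v *m (A i)^T)^T) 0 0.
  by rewrite -Acal_form vA -scalemxAl [RHS]mxE.
have vv : 0 < (v *m v^T) 0 0.
  rewrite lt_def gram_ge0 andbT; apply: contra v0 => /eqP z.
  by apply/eqP/gram_eq0/matrixP => a b; rewrite !ord1 z mxE.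
split; first by rewrite -(pmulr_lge0 x vv) E sumr_ge0.
move=> t0; apply/eqP => x0; move: E; rewrite x0 mul0r => /esym/eqP.
rewrite psumr_eq0 // => /allP H; case/negP: v0.
rewrite -[v]trmxK -trmx0; apply/eqP; congr (_^T); apply: hA => i ir.
have := H (Ordinal (ir : (i < r.+1)%N)) (mem_index_enum _) => /=.
rewrite mulf_eq0 expf_eq0 (negPf t0) andbF /= => /eqP z.
have /(congr1 trmx) : v *m (A i)^T = 0.
  by apply: gram_eq0; apply/matrixP => a b; rewrite !ord1 z mxE.
by rewrite trmx_mul trmxK trmx0.
Qed.

Lemma Acal_an x k : analytic0 (fun h => (char_poly (Acal A r (x + h)))`_k).
Proof.
suff H : analytic0p (fun h => char_poly (Acal A r (x + h))) by apply: H.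
apply: analytic0p_sum => s; apply: analytic0pM; first exact: analytic0p_cst.
apply: analytic0p_prod => i.
have Hij a b : analytic0 (fun h => (Acal A r (x + h)) a b).
  apply: (analytic0_eq (f := fun h => \sum_(i < r.+1) (x + h) ^+ (2 * i) * AtA A i a b)).
    by move=> h; rewrite /Acal summxE; apply: eq_bigr => l _; rewrite [RHS]mxE.
  apply: analytic0_sum => l _; apply: analytic0M (analytic0_cst _); apply: analytic0X.
  exact: analytic0D (analytic0_cst _) (@analytic0_id R).
apply: (analytic0p_eq (P := fun h => ('X *+ (i == s i)) + (- (Acal A r (x + h)) i (s i))%:P)).
  by move=> h; rewrite polyCN [RHS]mxE [X in _ = X + _]mxE [X in _ = _ + X]mxE [X in _ = _ - X]mxE.
by apply: analytic0pD; [apply: analytic0p_cst|apply/analytic0pC/analytic0N].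
Qed.

End PSD.

End Final.

Theorem theorem3p2 (R : realType) (d r : nat) (N : nat -> nat)
    (A : forall i : nat, 'M[R]_(N i, d)) :
  (forall x : 'cV[R]_d, (forall i : nat, (i <= r)%N -> A i *m x = 0) -> x = 0) ->
  ndim A r = d /\
  exists (g : 'I_d -> 'I_r.+1) (eta : 'I_d -> R -> R) (l : 'I_d -> R),
    [/\ (forall k, real_analytic (eta k)),
        (forall h : R, 0 <= h ->
           char_poly (Acal A r h)
           = \prod_(k < d) ('X - (h ^+ (2 * g k) * eta k h)%:P)),
        (forall j : 'I_r.+1,
           #|[pred k | g k == j]| = (ndim A j - nprev A j)%N),
        (forall k, eta k h @[h --> 0^'+] --> l k) &
        (forall j : 'I_r.+1,
           (forall k, g k = j -> l k != 0) /\
           (forall mu : R, mu != 0 ->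
              #|[pred k | (g k == j) && (l k == mu)]|
              = mup mu (char_poly (Ahat A j))))].
Proof.
move=> hA; split; first exact: ndim_full hA.
have [|||h|F HF] := @analytic_branches R d (fun h => char_poly (Acal A r h)).
- by move=> x k; apply: Acal_an.
- by move=> h; apply: char_poly_monic.
- by move=> h; apply: size_char_poly.
- exact/sym_real_rooted/Acal_sym.
have Froot k t : root (char_poly (Acal A r t)) (F k t).
  have [_ ->] := HF t; rewrite rootE horner_prod; apply/prodf_eq0; exists k => //.
  by rewrite hornerXsubC subrr.
have /choice[m /choice[eta Heta]] k : exists m e, [/\ forall x, analytic_at e x, e 0 != 0 &
    forall t, F k t = t ^+ (2 * m) * e t].
  apply: analytic0_even_order => [x|t|t t0]; first by have [/(_ k)] := HF x.
    by have [] := Acal_root hA (Froot k t).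
  by have [_ ->] := Acal_root hA (Froot k t).
have aeta k : analytic0 (eta k).
  by have [/(_ 0) H _ _] := Heta k; apply: analytic0_eq H => y; rewrite add0r.
have eta0 k : eta k 0 != 0 by have [] := Heta k.
have Hchar t : char_poly (Acal A r t) = \prod_k ('X - (t ^+ (2 * m k) * eta k t)%:P).
  by have [_ ->] := HF t; apply: eq_bigr => k _; have [_ _ ->] := Heta k.
(* For [j = r.+1], [nprev] is already [d], so no branch has order [r.+1] or more. *)
have mr k : (m k < r.+1)%N.
  have := count_ge hA aeta eta0 Hchar (leqnn r.+1); rewrite /= (ndim_full hA) => /eqP.
  rewrite -[X in _ == X]add0n eqn_add2r => /eqP/card0_eq/(_ k).
  by rewrite !inE ltnNge => /negbFE.
exists (fun k => inord (m k)), eta, (fun k => eta k 0).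
have gj k (j : 'I_r.+1) : (inord (m k) == j :> 'I_r.+1) = (m k == j).
  by rewrite -val_eqE /= inordK.
split.
- by move=> k; apply: analytic_at_real_analytic; have [] := Heta k.
- by move=> h _; rewrite Hchar; apply: eq_bigr => k _; rewrite inordK.
- move=> j.
  (* The branches of order exactly [j] are the difference between the counts at [j] and [j.+1],
     namely d - n_(j-1) and d - n_j. *)
  have h1 := count_ge hA aeta eta0 Hchar (ltnW (ltn_ord j)).
  have h2 := count_ge hA aeta eta0 Hchar (ltn_ord j).
  have : #|[pred k | (j <= m k)%N]| = (#|[pred k | inord (m k) == j]| + #|[pred k | (j < m k)%N]|)%N.
    rewrite -(cardID [pred k | inord (m k) == j]); congr (_ + _)%N; apply: eq_card => k; rewrite !inE gj.
      by case: eqVneq => [->|]; rewrite ?leqnn ?andbF.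
    by rewrite ltn_neqAle eq_sym.
  rewrite /= in h2; lia.
- by move=> k; apply: cvg_at_right_filter; apply: analytic0_continuous.
move=> j; split=> [k _|mu mu0]; first exact: eta0.
rewrite -(count_eigen hA aeta eta0 Hchar (ltnW (ltn_ord j)) mu0).
by apply: eq_card => k; rewrite !inE gj.
Qed.
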